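(* Let $n\ge1$. For every padded composition $c$ of length $n$, $\mathfrak F_c(x_1,\dots,x_n;\mathbf 0)=\mathfrak F_c(x_1,\dots,x_n)$, the ordinary fundamental quasisymmetric polynomial. Furthermore, the set $$\{\mathfrak P_F(\mathbf x;\mathbf t): F\in\mathrm{Zigzag}_n\}=\{\mathfrak F_c(x_1,\dots,x_n;\mathbf t): c\text{ a padded composition of length } n\}$$ is a $\mathbb Z[\mathbf t]$-basis of $\mathrm{EQSym}_n$.
   Context: $\mathbf x=(x_1,x_2,\dots)$, $\mathbf t=(t_1,t_2,\dots)$. For $f\in\mathbb Z[\mathbf t][\mathbf x]$ let $R_i^-f=f(x_1,\dots,x_{i-1},t_i,x_i,\dots;\mathbf t)$, $R_i^+f=f(x_1,\dots,x_i,t_i,x_{i+1},\dots;\mathbf t)$, $E_if=(R_i^+f-R_i^-f)/(x_i-t_i)$. $\mathrm{EQSym}_n=\{f\in\mathbb Z[\mathbf t][x_1,\dots,x_n]: R_i^+f=R_i^-f\text{ for }1\le i<n\}$ (equivariantly quasisymmetric polynomials). Indexed forests: a binary plane tree is a rooted tree each of whose nodes is a leaf or an internal node with ordered left and right children. An indexed forest is a sequence $F=(T_1,T_2,\dots)$ of binary plane trees, all but finitely many being the one-node tree; leaves are identified with $\mathbb N$ left to right; $\emptyset$ is the forest with no internal nodes. An internal node is terminal if both children are leaves; $\rho_F(v)$ is the leaf reached from $v$ by repeatedly going to left children; $\mathrm{Qdes}(F)=\{\rho_F(v): v\text{ terminal}\}$; for $i\in\mathrm{Qdes}(F)$, $F/i$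 is obtained by deleting the terminal node with $\rho_F(v)=i$ (replacing it and its leaves by one leaf, relabeling). The code of $F$ is the sequence $(c_i)_{i\ge1}$ with $c_i=\#\{v\text{ internal}:\rho_F(v)=i\}$; this is a bijection from indexed forests to finitely supported sequences of nonnegative integers. $\mathrm{Zigzag}_n=\{F:\mathrm{Qdes}(F)\subseteq\{n\}\}$. Double forest polynomials $\mathfrak P_F(\mathbf x;\mathbf t)$: the unique family of homogeneous polynomials ($\deg x_i=\deg t_i=1$) with $\mathfrak P_F(\mathbf t;\mathbf t)=\delta_{F,\emptyset}$ and $E_i\mathfrak P_F=\mathfrak P_{F/i}(\mathbf x;\widehat{\mathbf t}_i)$ if $i\in\mathrm{Qdes}(F)$, $0$ otherwise, where $\widehat{\mathbf t}_i=(t_1,\dots,t_{i-1},t_{i+1},\dots)$. A padded composition of length $n$ is $c=(0^{n-\ell},a_1,\dots,a_\ell)$ with $\ell\ge0$ and all $a_i>0$; $F_c$ is the indexed forest whose code is $c$ followed by zeros, and the double fundamental quasisymmetric polynomial is $\mathfrak F_c(x_1,\dots,x_n;\mathbf t):=\mathfrak P_{F_c}(\mathbf x;\mathbf t)$. The ordinary fundamental quasisymmetric polynomial is $\mathfrak F_c(x_1,\dots,x_n)=\sum x_{i_1}\cdots x_{i_m}$, $m=a_1+\dots+a_\ell$, summed over $1\le i_1\le\dots\le i_m\le n$ with $i_j<i_{j+1}$ whenever $j\in\{a_1,a_1+a_2,\dots,a_1+\dots+a_{\ell-1}\}$. *)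

(* Defs.v *)
From HB Require Import structures.
From mathcomp Require Import all_boot all_order all_algebra.
From mathcomp Require Import finmap.
From mathcomp.multinomials Require Import monalg.

Set Implicit Arguments.
Unset Strict Implicit.
Unset Printing Implicit Defensive.
Import GRing.Theory.
Local Open Scope ring_scope.

(* Variables.  INDEXING CONVENTION: internal index k : nat (0-based)
   stands for the paper's index k+1.  So  inl k = x_{k+1},
   inr k = t_{k+1}.  Likewise leaves of forests are numbered 0,1,2,...
   internally (paper: 1,2,3,...), and operators R_k, E_k internally
   correspond to the paper's R_{k+1}, E_{k+1}.                         *)
Definition var : choiceType := (nat + nat)%type.

Definition XTPoly := {malg int[cmonom var]}.

Definition mono (v : var) : XTPoly := << ucm v >>.
Definition xx (k : nat) : XTPoly := mono (inl k).
Definition tt (k : nat) : XTPoly := mono (inr k).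

Definition psubst (s : var -> XTPoly) (p : XTPoly) : XTPoly :=
  \sum_(m <- msupp p) (p@_m)%:MP * \prod_(v <- finsupp m) s v ^+ (m v).

Definition Rminus (k : nat) : XTPoly -> XTPoly :=
  psubst (fun v => match v with
                   | inl j => if (j < k)%N then xx j
                              else if j == k then tt k else xx j.-1
                   | inr j => tt j end).

Definition Rplus (k : nat) : XTPoly -> XTPoly :=
  psubst (fun v => match v with
                   | inl j => if (j <= k)%N then xx j
                              else if j == k.+1 then tt k else xx j.-1
                   | inr j => tt j end).

(* E_{k+1} f = g  :<=>  g = (R^+ f - R^- f)/(x_{k+1} - t_{k+1}),
   i.e. (x_{k+1} - t_{k+1}) g = R^+ f - R^- f (exact division in the
   integral domain Z[x,t]; such g is unique). *)
Definition E_is (k : nat) (f g : XTPoly) : Prop :=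
  (xx k - tt k) * g = Rplus k f - Rminus k f.

Definition that (k : nat) : XTPoly -> XTPoly :=
  psubst (fun v => match v with
                   | inl j => xx j
                   | inr j => if (j < k)%N then tt j else tt j.+1 end).

Definition at_xt : XTPoly -> XTPoly :=
  psubst (fun v => match v with inl j => tt j | inr j => tt j end).

Definition at_t0 : XTPoly -> XTPoly :=
  psubst (fun v => match v with inl j => xx j | inr j => 0 end).

Definition homogeneous (p : XTPoly) : Prop :=
  exists d : nat, forall m, m \in msupp p -> mdeg m = d.

Definition in_Zt_x (n : nat) (p : XTPoly) : Prop :=
  forall m, m \in msupp p -> forall j : nat, (n <= j)%N -> m (inl j) = 0%N.

Definition in_Zt (p : XTPoly) : Prop := in_Zt_x 0 p.

Definition EQSym (n : nat) (f : XTPoly) : Prop :=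
  in_Zt_x n f /\ forall k : nat, (k.+1 < n)%N -> Rplus k f = Rminus k f.

Definition is_Zt_basis_EQSym (n : nat) (S : XTPoly -> Prop) : Prop :=
  [/\ forall p, S p -> EQSym n p,
      forall f, EQSym n f ->
        exists (ps : seq XTPoly) (a : XTPoly -> XTPoly),
          [/\ forall p, p \in ps -> S p,
              forall p, p \in ps -> in_Zt (a p) &
              f = \sum_(p <- ps) a p * p] &
      forall (ps : seq XTPoly) (a : XTPoly -> XTPoly),
        uniq ps -> (forall p, p \in ps -> S p) ->
        (forall p, p \in ps -> in_Zt (a p)) ->
        \sum_(p <- ps) a p * p = 0 -> forall p, p \in ps -> a p = 0].

Inductive tree := Leaf | Node of tree & tree.

Fixpoint tree_eqb (a b : tree) : bool :=
  match a, b with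
  | Leaf, Leaf => true
  | Node l1 r1, Node l2 r2 => tree_eqb l1 l2 && tree_eqb r1 r2
  | _, _ => false
  end.

Lemma tree_eqP : Equality.axiom tree_eqb.
Proof.
elim=> [|l1 IHl r1 IHr] [|l2 r2] /=; try by constructor.
case: (IHl l2) => [->|h]; last by constructor; case.
case: (IHr r2) => [->|h]; last by constructor; case.
by constructor.
Qed.

HB.instance Definition _ := hasDecEq.Build tree tree_eqP.

Fixpoint nleaves (T : tree) : nat :=
  match T with Leaf => 1 | Node l r => nleaves l + nleaves r end.

Fixpoint rhos (o : nat) (T : tree) : seq nat :=
  match T with
  | Leaf => [::]
  | Node l r => o :: rhos o l ++ rhos (o + nleaves l) r
  end.

Fixpoint trhos (o : nat) (T : tree) : seq nat :=
  match T with
  | Leaf => [::]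
  | Node Leaf Leaf => [:: o]
  | Node l r => trhos o l ++ trhos (o + nleaves l) r
  end.

Fixpoint tdel (i o : nat) (T : tree) : tree :=
  match T with
  | Leaf => Leaf
  | Node Leaf Leaf => if o == i then Leaf else T
  | Node l r => Node (tdel i o l) (tdel i (o + nleaves l) r)
  end.

(* An indexed forest (T_1, T_2, ...) is represented by the finite list of
   its trees up to the last non-trivial one (all later T_j are one-node
   trees); this representation is canonical (no trailing Leaf). *)
Fixpoint trim_rev (s : seq tree) : seq tree :=
  match s with
  | Leaf :: s' => trim_rev s'
  | _ => s
  end.
Definition trim (s : seq tree) : seq tree := rev (trim_rev (rev s)).
Definition trimmed (s : seq tree) : bool := trim s == s.

Lemma trim_revK s : trim_rev (trim_rev s) = trim_rev s.
Proof. by elim: s => [|[|l r] s IH] //=. Qed.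

Lemma trim_trimmed s : trimmed (trim s).
Proof. by rewrite /trimmed /trim revK trim_revK. Qed.

Definition forest := {s : seq tree | trimmed s}.

Definition empty_forest : forest := exist _ [::] (eqxx _).

Fixpoint frhos_s (o : nat) (s : seq tree) : seq nat :=
  if s is T :: s' then rhos o T ++ frhos_s (o + nleaves T) s' else [::].
Fixpoint ftrhos_s (o : nat) (s : seq tree) : seq nat :=
  if s is T :: s' then trhos o T ++ ftrhos_s (o + nleaves T) s' else [::].
Fixpoint fdel_s (i o : nat) (s : seq tree) : seq tree :=
  if s is T :: s' then tdel i o T :: fdel_s i (o + nleaves T) s' else [::].

Definition Qdes (F : forest) : seq nat := ftrhos_s 0 (sval F).

Definition code (F : forest) (i : nat) : nat := count_mem i (frhos_s 0 (sval F)).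

(* F / i  (meaningful for i \in Qdes F) *)
Definition fquot (F : forest) (i : nat) : forest :=
  exist _ (trim (fdel_s i 0 (sval F))) (trim_trimmed _).

(* Zigzag_n = {F : Qdes F \subseteq {n}}  (paper leaf n = internal n-1) *)
Definition zigzag (n : nat) (F : forest) : bool := all (pred1 n.-1) (Qdes F).

Definition double_forest_family (P : forest -> XTPoly) : Prop :=
  [/\ forall F, homogeneous (P F),
      forall F, at_xt (P F) = (if sval F == [::] then 1 else 0) &
      forall F k,
        if k \in Qdes F then E_is k (P F) (that k (P (fquot F k)))
        else E_is k (P F) 0].

Definition padded_comp (n : nat) (c : seq nat) : bool :=
  (size c == n) &&
  [exists l : 'I_n.+1, all (pred1 0%N) (take (n - l) c) && all (leq 1) (drop (n - l) c)].

Definition has_code (F : forest) (c : seq nat) : Prop :=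
  forall i : nat, code F i = nth 0%N c i.

Definition comp_of (c : seq nat) : seq nat := filter (leq 1) c.
Definition descset (a : seq nat) : seq nat :=
  [seq sumn (take j a) | j <- iota 1 (size a).-1].

(* condition on the (0-based) index sequence s = (i_1 - 1, ..., i_m - 1):
   i_j <= i_{j+1}, and i_j < i_{j+1} whenever j \in D *)
Definition fqs_ok (D : seq nat) (s : seq nat) : bool :=
  all (fun j => (nth 0 s j.-1 <= nth 0 s j)%N &&
                ((j \in D) ==> (nth 0 s j.-1 < nth 0 s j)%N))
      (iota 1 (size s).-1).

Definition fundamental (n : nat) (c : seq nat) : XTPoly :=
  let a := comp_of c in
  \sum_(s : (sumn a).-tuple 'I_n | fqs_ok (descset a) (map val s))
     \prod_(i <- s) xx (val i).

(* Main.v *)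
Require Import Defs.
From HB Require Import structures.
From mathcomp Require Import all_boot all_order all_algebra.
From mathcomp Require Import finmap zify.
From mathcomp.multinomials Require Import monalg.

(** A forest in Zigzag_n is a single caterpillar, so it is the same thing as a composition a
    with at most n parts (its code), and deleting its terminal node lowers the last part of a by
    one.  Comparing coefficients of t-degree 0 in E_n P_F = P_{F/n} therefore computes the
    coefficients of P_F(x;0) recursively, because membership in EQSym_n makes the coefficients of
    lowest t-degree invariant under sliding an exponent over a zero exponent; the result is the
    fundamental quasisymmetric polynomial.

    For the basis property, slide all exponents to the right end: the coefficients of lowest
    t-degree of f in EQSym_n are determined by those at t^b x_{n-l+1}^{a_1} ... x_n^{a_l}.
    At monomials of this shape, the family t^b P_F is unitriangular for the order by t-degree
    of b, then by l.  Homogeneity bounds the t-degree, so successive elimination terminates;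
    the same triangularity gives linear independence. *)

Set Implicit Arguments.
Unset Strict Implicit.
Unset Printing Implicit Defensive.
Import GRing.Theory.

(** * Forests and codes *)

Lemma nleaves_gt0 T : 0 < nleaves T.
Proof. by elim: T => //= l IHl r _; rewrite addn_gt0 IHl. Qed.

Lemma rhos_bounds o T : all (fun i => o <= i < o + nleaves T) (rhos o T).
Proof.
elim: T o => //= l IHl r IHr o.
have l0 := nleaves_gt0 l; have r0 := nleaves_gt0 r.
apply/andP; split; first by lia.
rewrite all_cat; apply/andP; split.
  by apply: sub_all (IHl o) => i; lia.
by apply: sub_all (IHr (o + nleaves l)) => i; lia.
Qed.

Lemma frhos_bounds o s : all (leq o) (frhos_s o s).
Proof.
elim: s o => //= T s IH o; rewrite all_cat; apply/andP; split.
  by apply: sub_all (rhos_bounds o T) => i /andP[].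
by apply: sub_all (IH (o + nleaves T)) => i; lia.
Qed.

Lemma sorted_cat_leq (s1 s2 : seq nat) b :
  sorted leq s1 -> sorted leq s2 -> all (fun i => i <= b) s1 -> all (leq b) s2 ->
  sorted leq (s1 ++ s2).
Proof.
move=> h1 h2 /allP b1 /allP b2; rewrite sorted_pairwise; last exact: leq_trans.
rewrite pairwise_cat -!sorted_pairwise ?h1 ?h2; try exact: leq_trans.
rewrite !andbT; apply/allrelP => i j /b1 ? /b2 ?; lia.
Qed.

(** Labels of the left subtree lie below [o + nleaves l], where those of the right subtree start.
    The code records only multiplicities, and these determine a sorted list. *)
Lemma rhos_sorted o T : sorted leq (rhos o T).
Proof.
elim: T o => //= l IHl r IHr o.
rewrite path_sortedE; last exact: leq_trans.
rewrite all_cat -andbA; apply/and3P; split.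
- by apply: sub_all (rhos_bounds o l) => i /andP[].
- by apply: sub_all (rhos_bounds (o + nleaves l) r) => i; lia.
apply: (sorted_cat_leq (b := o + nleaves l)) (IHl o) (IHr _) _ _.
  by apply: sub_all (rhos_bounds o l) => i; lia.
by apply: sub_all (rhos_bounds (o + nleaves l) r) => i; lia.
Qed.

Lemma frhos_sorted o s : sorted leq (frhos_s o s).
Proof.
elim: s o => //= T s IH o.
apply: (sorted_cat_leq (b := o + nleaves T)) (rhos_sorted o T) (IH _) _ (frhos_bounds _ _).
by apply: sub_all (rhos_bounds o T) => i; lia.
Qed.

(* Preorder lists the labels increasingly, so the tree is read off from left to right: it is a
   [Node] iff the next label is the current leaf [o]. *)
Lemma rhos_parse T T' o w w' :
  all (leq (o + nleaves T)) w -> all (leq (o + nleaves T')) w' ->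
  rhos o T ++ w = rhos o T' ++ w' -> T = T' /\ w = w'.
Proof.
elim: T T' o w w' => [|l IHl r IHr] [|l' r'] o w w' //=.
- by move=> hw _ e; move: hw; rewrite e /=; lia.
- by move=> _ hw' e; move: hw'; rewrite -e /=; lia.
move=> hw hw' [] /eqP; rewrite -!catA => /eqP e.
have bnd l0 r0 w0 : all (leq (o + (nleaves l0 + nleaves r0))) w0 ->
    all (leq (o + nleaves l0)) (rhos (o + nleaves l0) r0 ++ w0).
  move=> h; rewrite all_cat; apply/andP; split.
    by apply: sub_all (rhos_bounds _ _) => i /andP[].
  by apply: sub_all h => i; lia.
have [el e2] := IHl _ _ _ _ (bnd _ _ _ hw) (bnd _ _ _ hw') e; subst l'.
by move: hw hw' e2; rewrite !addnA => hw hw' /(IHr _ _ _ _ hw hw')[-> ->].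
Qed.

Lemma trimmed_last s : trimmed s -> last (Node Leaf Leaf) s != Leaf.
Proof.
case/lastP: s => // s T; rewrite /trimmed /trim rev_rcons last_rcons.
case: T => //=; move/eqP/(congr1 size); rewrite size_rev size_rcons => e.
suff: size (trim_rev (rev s)) <= size s by rewrite e ltnn.
rewrite -(size_rev s); elim: (rev s) => //= -[|l r] s' IH //=; lia.
Qed.

Lemma frhos_nil s o : last (Node Leaf Leaf) s != Leaf -> frhos_s o s = [::] -> s = [::].
Proof.
case: s o => // T s o; rewrite [last _ _]/=; elim: s T o => [[]|T' s IH T o] //.
by rewrite [last _ _]/= => /IH{}IH /=; case: (rhos o T) => // /IH.
Qed.

Lemma frhos_inj s s' o :
  last (Node Leaf Leaf) s != Leaf -> last (Node Leaf Leaf) s' != Leaf ->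
  frhos_s o s = frhos_s o s' -> s = s'.
Proof.
elim: s s' o => [|T s IH] s' o hs hs' e; first by rewrite (frhos_nil hs' (esym e)).
case: s' hs' e => [|T' s'] hs' e; first by rewrite (frhos_nil hs e).
have lastE T0 s0 : last (Node Leaf Leaf) (T0 :: s0) != Leaf ->
    last (Node Leaf Leaf) s0 != Leaf by case: s0.
have [eT e'] := rhos_parse (frhos_bounds _ _) (frhos_bounds _ _) e; subst T'.
by rewrite (IH _ _ (lastE _ _ hs) (lastE _ _ hs') e').
Qed.

(** Multiplicities determine a sorted list, so the code recovers the preorder list of labels, and
    parsing that list recovers the forest. *)
Lemma code_inj F F' : code F =1 code F' -> F = F'.
Proof.
case: F F' => [s hs] [s' hs'] /= e; apply: val_inj => /=.
apply: (@frhos_inj _ _ 0); try exact: trimmed_last.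
apply: (sorted_eq leq_trans anti_leq); try exact: frhos_sorted.
by apply/allP => i _; apply/eqP; apply: e.
Qed.

(** The caterpillar of a composition: a part x >= 1 becomes x internal nodes along left edges,
    sharing their leftmost leaf; the remaining parts hang to the right of the lowest of them, one
    leaf further on. *)
Fixpoint ctree (a : seq nat) : tree :=
  if a is x :: a' then iter x.-1 (fun T => Node T Leaf) (Node Leaf (ctree a')) else Leaf.

(* Compositions are passed around reversed (last part first), since the recursion on F/n acts on
   the last part. *)
Definition cseq (n : nat) (ra : seq nat) : seq tree :=
  if ra is [::] then [::] else rcons (nseq (n - size ra) Leaf) (ctree (rev ra)).

Lemma ctree_leaf a : (ctree a == Leaf) = (a == [::]).
Proof. by case: a => [|[|[|x]] a]. Qed.

Lemma trim_rcons s T : T != Leaf -> trim (rcons s T) = rcons s T.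
Proof. by rewrite /trim rev_rcons; case: T => //= l r _; rewrite rev_cons revK. Qed.

Lemma trim_nseq k : trim (nseq k Leaf) = [::].
Proof. by rewrite /trim rev_nseq; elim: k. Qed.

Lemma cseq_trimmed n ra : trimmed (cseq n ra).
Proof.
case: ra => // x ra; rewrite /trimmed trim_rcons // ctree_leaf.
by rewrite -size_eq0 size_rev.
Qed.

Definition cforest n ra : forest := exist _ (cseq n ra) (cseq_trimmed n ra).

Lemma iter_trhos o x T : T != Leaf ->
  trhos o (iter x (fun T => Node T Leaf) T) = trhos o T.
Proof.
move=> nT; elim: x => //= x IH.
have : iter x (fun T => Node T Leaf) T != Leaf by case: x {IH}.
by case: (iter x _ T) IH => // l r <- _; rewrite /= cats0.
Qed.

Lemma trhos_ctree o a x : all (leq 1) (rcons a x) ->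
  trhos o (ctree (rcons a x)) = [:: o + size a].
Proof.
elim: a o => [|y a IH] o; rewrite ?rcons_cons [ctree _]/= iter_trhos //.
  by rewrite addn0.
move=> /= /andP[_ /IH{}IH].
have := ctree_leaf (rcons a x); rewrite -size_eq0 size_rcons.
by case: (ctree _) (IH (o + 1)) => //= l r -> _; rewrite -addnA add1n.
Qed.

Lemma ftrhos_nseq k o s : ftrhos_s o (nseq k Leaf ++ s) = ftrhos_s (o + k) s.
Proof. by elim: k o => [|k IH] o /=; rewrite ?addn0 // IH addn1 addSnnS. Qed.

Lemma frhos_nseq k o s : frhos_s o (nseq k Leaf ++ s) = frhos_s (o + k) s.
Proof. by elim: k o => [|k IH] o /=; rewrite ?addn0 // IH addn1 addSnnS. Qed.

Lemma fdel_nseq i k o s : fdel_s i o (nseq k Leaf ++ s) = nseq k Leaf ++ fdel_s i (o + k) s.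
Proof. by elim: k o => [|k IH] o /=; rewrite ?addn0 // IH addn1 addSnnS. Qed.

Lemma Qdes_cforest n x ra : all (leq 1) (x :: ra) -> size (x :: ra) <= n ->
  Qdes (cforest n (x :: ra)) = [:: n.-1].
Proof.
move=> pos sz; rewrite /Qdes /= -cats1 ftrhos_nseq /= cats0 rev_cons.
rewrite trhos_ctree ?size_rev; first by congr cons; move: sz => /=; lia.
by rewrite -rev_cons all_rev.
Qed.

Lemma iter_tdel i o x T : T != Leaf ->
  tdel i o (iter x (fun T => Node T Leaf) T) = iter x (fun T => Node T Leaf) (tdel i o T).
Proof.
move=> nT; elim: x => //= x IH.
have : iter x (fun T => Node T Leaf) T != Leaf by case: x {IH}.
by case: (iter x _ T) IH => // l r <- _.
Qed.

Lemma tdel_ctree o a x : all (leq 1) (rcons a x) ->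
  tdel (o + size a) o (ctree (rcons a x)) =
  ctree (if x == 1 then a else rcons a x.-1).
Proof.
elim: a o => [|y a IH] o; rewrite ?rcons_cons [ctree (_ :: _)]/= iter_tdel //.
  rewrite addn0 /= eqxx; case: x => [|[|x]] //= _; by elim: x => //= x <-.
move=> /= /andP[_ /(IH (o + 1))]; rewrite -addnA add1n => {}IH.
have := ctree_leaf (rcons a x); rewrite -size_eq0 size_rcons.
case: (ctree (rcons a x)) IH => //= l r e _; rewrite e.
by case: ifP.
Qed.

(** Losing a last part 1 keeps the number of leading leaves but removes a part, which is why the
    length drops to [n.-1]. If no part is left, only leaves remain and they are trimmed. *)
Lemma fquot_cforest n x ra : all (leq 1) (x :: ra) -> size (x :: ra) <= n ->
  fquot (cforest n (x :: ra)) n.-1 =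
  if x == 1 then cforest n.-1 ra else cforest n (x.-1 :: ra).
Proof.
move=> pos sz; apply: val_inj => /=; rewrite -cats1 fdel_nseq /= add0n.
have -> : n.-1 = n - (size ra).+1 + size (rev ra) by rewrite size_rev; move: sz => /=; lia.
rewrite rev_cons tdel_ctree; last by rewrite -rev_cons all_rev.
rewrite cats1.
case: eqP => [x1|nx1] /=.
  case: ra pos sz => [|y ra] pos sz.
    by rewrite -cats1 -(nseqD _ 1) trim_nseq.
  rewrite trim_rcons ?ctree_leaf -?size_eq0 ?size_rev //=.
  by congr (rcons (nseq _ _) _); move: sz; rewrite /= ?size_rev /=; lia.
by rewrite rev_cons trim_rcons // ctree_leaf -size_eq0 size_rcons.
Qed.

Definition rcomp (n : nat) (ra : seq nat) := all (leq 1) ra && (size ra <= n).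

Lemma frhos_ctree_count o a i : all (leq 1) a ->
  count_mem i (rhos o (ctree a)) = if i < o then 0 else nth 0 a (i - o).
Proof.
elim: a o => [|x a IH] o /=; first by rewrite nth_nil if_same.
case: x => //= x pos; have iterE k : count_mem i (rhos o (iter k (fun T => Node T Leaf)
   (Node Leaf (ctree a)))) = (o == i) * k.+1 + count_mem i (rhos o.+1 (ctree a)).
  elim: k => [|k IHk] /=; [by rewrite addn1 muln1|].
  by rewrite cats0 IHk addnA -mulnS.
rewrite iterE IH // ltnS; case: (ltngtP i o) => oi.
- by [].
- by rewrite mul0n add0n subnS; case: (i - o) (subn_gt0 o i) => [|k] //=; rewrite oi.
- by rewrite oi subnn mul1n addn0.
Qed.

Lemma code_cforest n ra : rcomp n ra ->
  has_code (cforest n ra) (nseq (n - size ra) 0 ++ rev ra).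
Proof.
case/andP => pos sz i; rewrite /code /=.
case: ra pos sz => [|x ra] pos sz; first by rewrite cats0 nth_nseq if_same.
rewrite /cseq -cats1 frhos_nseq /= cats0 add0n frhos_ctree_count ?all_rev //.
by rewrite nth_cat size_nseq nth_nseq; case: ltnP.
Qed.

Lemma padded_compP n c : reflect (exists2 ra, rcomp n ra & c = nseq (n - size ra) 0 ++ rev ra)
  (padded_comp n c).
Proof.
apply: (iffP andP) => [[/eqP sc /existsP[l /andP[h0 h1]]]|[ra /andP[pos sz] ->]].
  have ln : l <= n by rewrite -ltnS.
  have sd : size (drop (n - l) c) = l by rewrite size_drop sc; lia.
  exists (rev (drop (n - l) c)).
    by rewrite /rcomp all_rev h1 size_rev sd.
  rewrite revK size_rev sd -{1}(cat_take_drop (n - l) c); congr (_ ++ _).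
  have st : size (take (n - l) c) = n - l by rewrite size_takel // sc; lia.
  by rewrite -{2}st; apply/all_pred1P.
split; first by rewrite size_cat size_nseq size_rev; apply/eqP; lia.
apply/existsP; have sl : size ra < n.+1 by [].
exists (Ordinal sl) => /=; rewrite take_size_cat ?size_nseq // drop_size_cat ?size_nseq //.
by rewrite all_rev pos all_nseq /= orbT.
Qed.

Lemma trhos_neq_nil T o : T != Leaf -> trhos o T != [::].
Proof.
elim: T o => // -[|l1 r1] IHl [|l2 r2] IHr o // _.
- exact: IHr (o + 1) isT.
- by have := IHl o isT; rewrite -!size_eq0 [trhos o (Node _ Leaf)]/= cats0.
- have -> : trhos o (Node (Node l1 r1) (Node l2 r2)) =
    trhos o (Node l1 r1) ++ trhos (o + nleaves (Node l1 r1)) (Node l2 r2) by [].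
  by have := IHl o isT; rewrite -!size_eq0 size_cat addn_eq0 negb_and => ->.
Qed.

Lemma trhos_bounds o T : all (fun i => o <= i < o + nleaves T) (trhos o T).
Proof.
elim: T o => // l IHl r IHr o.
have l0 := nleaves_gt0 l; have r0 := nleaves_gt0 r.
have: all (fun i => o <= i < o + (nleaves l + nleaves r))
   (trhos o l ++ trhos (o + nleaves l) r).
  rewrite all_cat; apply/andP; split.
    by apply: sub_all (IHl o) => i; lia.
  by apply: sub_all (IHr (o + nleaves l)) => i; lia.
by case: l {IHl} l0 => [|l1 r1]; case: r {IHr} r0 => [|l2 r2] //=; lia.
Qed.

(** Two internal children would each contain a terminal node, with labels in disjoint ranges of
    leaves, so not both equal to [i]. Hence each node has at most one internal child: on the left it
    raises the first part by one, on the right it prepends a part 1. *)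
Lemma zigzag_tree i o T : T != Leaf -> all (pred1 i) (trhos o T) ->
  exists2 a, all (leq 1) a & (T = ctree a) /\ (o + size a = i.+1).
Proof.
elim: T o => // l IHl r IHr o _ h.
case: l IHl h => [|l1 r1] IHl; case: r IHr => [|l2 r2] IHr h.
- by exists [:: 1] => //; split => //; move: h => /=; rewrite andbT => /eqP; lia.
- have /= h' : all (pred1 i) (trhos (o + 1) (Node l2 r2)) by [].
  have [a pos [Ta sa]] := IHr _ isT h'; exists (1 :: a) => //.
  by split; [rewrite Ta | move: sa => /=; lia].
- have h' : all (pred1 i) (trhos o (Node l1 r1)).
    by move: h; rewrite [trhos _ _]/= cats0.
  have [a pos [Ta sa]] := IHl _ isT h'.
  case: a pos Ta sa => [|[|x] a] pos Ta sa //.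
  by exists (x.+2 :: a) => //; split => //; rewrite Ta.
- move: h; set L := Node l1 r1; set R := Node l2 r2.
  have -> : trhos o (Node L R) = trhos o L ++ trhos (o + nleaves L) R by [].
  rewrite all_cat => /andP[].
  have := trhos_neq_nil o (isT : L != Leaf).
  have := trhos_neq_nil (o + nleaves L) (isT : R != Leaf).
  have := trhos_bounds o L; have := trhos_bounds (o + nleaves L) R.
  case: (trhos o L) => // i1 s1; case: (trhos _ R) => // i2 s2 /=.
  by move=> /andP[h1 _] /andP[h2 _] _ _ /andP[/eqP e1 _] /andP[/eqP e2 _]; lia.
Qed.

Lemma zigzagP n F : 0 < n -> reflect (exists2 ra, rcomp n ra & F = cforest n ra) (zigzag n F).
Proof.
move=> n0; apply: (iffP idP) => [|[ra /andP[pos sz] ->]]; last first.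
  case: ra pos sz => // x ra pos sz; rewrite /zigzag Qdes_cforest //=.
  by rewrite eqxx.
case: F => s; case/lastP: s => [|s T] hs.
  by move=> _; exists [::] => //; apply: val_inj.
rewrite /zigzag /Qdes /= => h.
have nT : T != Leaf by have := trimmed_last hs; rewrite last_rcons.
suff [e h'] : s = nseq (size s) Leaf /\ all (pred1 n.-1) (trhos (size s) T).
  have [a pos [Ta sa]] := zigzag_tree nT h'.
  exists (rev a); first by rewrite /rcomp all_rev pos size_rev; lia.
  apply: val_inj => /=; rewrite /cseq.
  case: (rev a) (revK a) (size_rev a) => [|x ra] ea sz.
    by move: nT; rewrite Ta -ea.
  by rewrite ea -Ta e; congr (rcons (nseq _ _) _); move: sa; rewrite -sz ?size_nseq; lia.
suff: forall o, all (pred1 n.-1) (ftrhos_s o (rcons s T)) ->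
   s = nseq (size s) Leaf /\ all (pred1 n.-1) (trhos (o + size s) T).
  by move=> /(_ 0); apply.
elim: {hs h} s => [|T1 s IH] o /=; first by rewrite cats0 addn0.
rewrite all_cat => /andP[h1 h2]; have [e h3] := IH _ h2.
have bT := trhos_bounds (o + nleaves T1 + size s) T.
have n2 := trhos_neq_nil (o + nleaves T1 + size s) nT.
(* A nontrivial [T1] would have a terminal label below every terminal label of [T], yet both would
   equal [n.-1]. *)
have T1L : T1 = Leaf.
  apply/eqP; apply/contraT => nT1.
  have := trhos_bounds o T1; have := trhos_neq_nil o nT1.
  case: (trhos o T1) h1 => // i1 s1 /= /andP[/eqP-> _] _ /andP[b1 _].
  by case: (trhos _ T) h3 bT n2 => // i2 s2 /= /andP[/eqP-> _] /andP[? _]; lia.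
by rewrite T1L -e; move: h3; rewrite T1L /= addn1 addSnnS.
Qed.

(** * Words *)

(* [w] is a monomial of the fundamental polynomial of [rev ra], read as a weakly decreasing word:
   the first letter of [w] is the largest index. *)
Fixpoint word_ok (ra w : seq nat) : bool :=
  match w, ra with
  | [::], [::] => true
  | j :: w', x :: ra' =>
      if x <= 1 then word_ok ra' w' && (if w' is h :: _ then h < j else true)
      else word_ok (x.-1 :: ra') w' && (if w' is h :: _ then h <= j else true)
  | _, _ => false
  end.

Arguments word_ok : simpl never.

Lemma word_ok_cons x ra j w : word_ok (x :: ra) (j :: w) =
  if x <= 1 then word_ok ra w && (if w is h :: _ then h < j else true)
  else word_ok (x.-1 :: ra) w && (if w is h :: _ then h <= j else true).
Proof. by []. Qed.

(* The word of the leading monomial, whose exponents at n.-1, n.-2, ... are the entries of [ra]. *)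
Fixpoint cword (n : nat) (ra : seq nat) : seq nat :=
  if ra is x :: ra' then nseq x n.-1 ++ cword n.-1 ra' else [::].

(** Consecutive parts are separated by a strict descent, so the word takes at least [size ra]
    distinct values between [lo] and [j]. *)
Lemma word_ok_size ra j w lo : word_ok ra (j :: w) -> all (leq lo) (j :: w) -> size ra + lo <= j.+1.
Proof.
elim: w ra j => [|h w IH] [|x ra] j //; rewrite word_ok_cons /=.
  case: ifP => _; last by [].
  by case: ra => //= _; rewrite andbT => lj; lia.
case: ifP => _ /andP[hw hj] /and3P[lj lh lw]; have := IH _ _ hw;
  rewrite /= lh lw => /(_ isT); lia.
Qed.

(** At most [size ra] values are available, so there is no slack: the first letter is [n.-1] and
    each strict descent drops by exactly one. *)
Lemma word_ok_lead ra w lo n : all (leq 1) ra -> word_ok ra w ->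
  all (fun i => lo <= i < n) w -> n <= size ra + lo -> w = cword n ra.
Proof.
elim: w ra n => [|j w IH] [|x ra] n // pos hw bw ns.
have lw : all (leq lo) (j :: w) by apply: sub_all bw => i /andP[].
have jn : j = n.-1.
  by have := word_ok_size hw lw; move: ns bw => /= ns; case/andP => /andP[_ ?] _; lia.
move: hw pos bw; rewrite word_ok_cons /=; case: x ns => [|[|x]] ns //= /andP[hw hd] pos.
  case/andP => bj bw; rewrite jn; congr cons; apply: IH => //; last by move: ns => /=; lia.
  case: w hw hd bw {lw} => [|h w] // hw hd.
  (* The word is weakly decreasing, so the strict descent to [h] puts all remaining letters below
     [n.-1]. *)
  have: sorted geq (h :: w).
    elim: w h ra hw {hd pos ns} => [|h' w IHw] h [|y ra] //; rewrite word_ok_cons.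
    by case: ifP => _ /andP[/IHw /= -> ]; rewrite andbT => //; apply: ltnW.
  rewrite /= path_sortedE; last by move=> a b c; rewrite /= => ba cb; apply: leq_trans cb ba.
  case/andP => /allP ub _ /andP[bh /allP bw]; apply/andP; split; first by lia.
  by apply/allP => i iw; have /= := ub _ iw; have := bw _ iw; lia.
case/andP => bj bw; rewrite jn; congr cons.
by apply: (IH (x.+1 :: ra)).
Qed.

Lemma cword_bounds n ra : size ra <= n -> all (fun i => n - size ra <= i < n) (cword n ra).
Proof.
elim: ra n => //= x ra IH n sz; rewrite all_cat all_nseq; apply/andP; split; first by lia.
have /IH : size ra <= n.-1 by lia.
by apply: sub_all => i; lia.
Qed.

Lemma cword_sorted n ra : size ra <= n -> sorted geq (cword n ra).
Proof.
have tr : transitive geq by move=> a b c /= ba cb; apply: leq_trans cb ba.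
elim: ra n => //= x ra IH n sz.
have sz' : size ra <= n.-1 by lia.
rewrite sorted_pairwise // pairwise_cat -!sorted_pairwise // IH // andbT.
apply/andP; split; last by elim: x => //= x; case: x => //= x ->; rewrite leqnn.
apply/allrelP => i j /nseqP[-> _] /(allP (cword_bounds sz')) /=; lia.
Qed.

Lemma word_ok_cword n ra : rcomp n ra -> word_ok ra (cword n ra).
Proof.
elim: ra n => // x ra IH n /andP[/= /andP[x0 pos] sz].
have h : word_ok ra (cword n.-1 ra) by apply: IH; rewrite /rcomp pos; lia.
have bnd : size ra <= n.-1 by lia.
case: x x0 => // x _; elim: x => [|x IHx]; rewrite word_ok_cons /=; last first.
  by rewrite IHx; case: x {IHx} => //=.
rewrite h /=; have := cword_bounds bnd; case: (cword _ _) => //= i w /andP[]; lia.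
Qed.

Lemma fqs_ok_rcons D s j : fqs_ok D (rcons s j) =
  fqs_ok D s && ((s == [::]) || (last 0 s <= j) && ((size s \in D) ==> (last 0 s < j))).
Proof.
case/lastP: s => [|s i]; first by [].
have ei : iota 1 (size (rcons (rcons s i) j)).-1 = iota 1 (size s) ++ [:: (size s).+1].
  by have := iotaD 1 (size s) 1; rewrite addn1 !size_rcons.
rewrite {1}/fqs_ok ei all_cat /=; congr (_ && _).
  rewrite /fqs_ok size_rcons /=; apply: eq_in_all => k; rewrite mem_iota => ks.
  rewrite !(nth_rcons _ (rcons s i)) size_rcons; have -> : k.-1 < (size s).+1 by lia.
  by have -> : k < (size s).+1 by lia.
rewrite andbT !(nth_rcons _ (rcons s i)) size_rcons /= ltnSn ltnn eqxx.
by rewrite nth_rcons ltnn eqxx last_rcons -size_eq0 size_rcons.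
Qed.

Lemma eq_fqs_ok D D' s : (forall k, 0 < k < size s -> (k \in D) = (k \in D')) ->
  fqs_ok D s = fqs_ok D' s.
Proof.
move=> e; apply: eq_in_all => k; rewrite mem_iota => ks; rewrite e //.
by case: s ks {e} => //= *; lia.
Qed.

(** The last part creates no descent, so lowering it does not change the descent set. *)
Lemma descset_rcons a x : descset (rcons a x) = [seq sumn (take j a) | j <- iota 1 (size a)].
Proof.
rewrite /descset size_rcons; apply/eq_in_map => j; rewrite mem_iota => ja.
by rewrite -cats1 takel_cat //; lia.
Qed.

Lemma descset_rcons2 a y x :
  descset (rcons (rcons a y) x) = rcons (descset (rcons a y)) (sumn (rcons a y)).
Proof.
have ei : iota 1 (size (rcons a y)) = iota 1 (size a) ++ [:: (size a).+1].
  by have := iotaD 1 (size a) 1; rewrite addn1 size_rcons.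
rewrite descset_rcons ei map_cat [map _ [:: _]]/= cats1.
rewrite take_oversize ?size_rcons //; congr rcons; rewrite descset_rcons.
apply/eq_in_map => j; rewrite mem_iota => ja; rewrite -cats1 takel_cat //; lia.
Qed.

Lemma descset_le a x k : k \in descset (rcons a x) -> k <= sumn a.
Proof.
rewrite descset_rcons => /mapP[j _ ->].
by rewrite -{2}(cat_take_drop j a) sumn_cat leq_addr.
Qed.

(** Links the letter-by-letter recursion with the descent condition in [fundamental]: the first
    letter of [w] is the last letter of its reversal. *)
Lemma word_ok_fqs ra w : all (leq 1) ra ->
  word_ok ra w = (size w == sumn (rev ra)) && fqs_ok (descset (rev ra)) (rev w).
Proof.
elim: w ra => [|j w IH] [|x ra] //.
- by rewrite /= => /andP[x0 _]; rewrite rev_cons sumn_rcons; case: eqP => //; lia.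
move=> /= /andP[x0 pos]; rewrite word_ok_cons !rev_cons sumn_rcons fqs_ok_rcons size_rev.
have hdE (P : nat -> bool) : (rev w == [::]) || P (last 0 (rev w)) =
     (if w is h :: _ then P h else true).
  by case: w {IH} => // h w; rewrite rev_cons last_rcons -size_eq0 size_rcons.
rewrite (hdE (fun h => (h <= j) && ((size w \in descset (rcons (rev ra) x)) ==> (h < j)))).
case: x x0 => [|[|x]] //= _; rewrite IH //.
  rewrite addn1 eqSS -!andbA; case: eqP => //= sw.
  case: ra pos sw {IH} => [|y ra] pos sw; first by case: w sw {hdE}.
  rewrite rev_cons descset_rcons2 -rev_cons.
  (* The extra descent is at position [size w], just past the steps inside [rev w]: it leaves the
     condition on [rev w] unchanged and makes the step to [j] strict. *)
  rewrite (@eq_fqs_ok _ (descset (rev (y :: ra))) (rev w)); last first.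
    by move=> k; rewrite size_rev mem_rcons inE sw; case: eqP => //; lia.
  congr (_ && _); rewrite mem_rcons inE sw eqxx /=; case: w {sw hdE} => // h w.
  by case: ltngtP.
rewrite [rev (_ :: ra)]rev_cons sumn_rcons !addnS eqSS -!andbA; case: eqP => //= sw.
congr (_ && _); first by rewrite !descset_rcons.
(* The last part is at least 2, so [size w] exceeds the sum of the earlier parts and the step to [j]
   is only weak. *)
have /negbTE -> : size w \notin descset (rcons (rev ra) x.+2).
  by apply/negP => /descset_le; rewrite sw; lia.
by case: w {IH sw hdE} => // h w; rewrite andbT.
Qed.

Local Open Scope ring_scope.

Local Notation mon := (cmonom var).
Local Notation "a ** b" := (@mmul (cmonom var) a b) (at level 40, left associativity).
Local Notation m1 := (@mone (cmonom var)).
Local Notation X j := (inl j : var).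
Local Notation T j := (inr j : var).

Implicit Types (m : mon) (p f : XTPoly) (v : var).

(** * Monomials and renaming of variables *)

(** One additive functional covers total degree, t-degree and single exponents, so that facts about
    renamed monomials reduce to facts about weights. *)
Definition wdeg (w : var -> nat) m : nat := (\sum_(v <- finsupp m) w v * m v)%N.

Lemma wdegEw (w : var -> nat) m (d : {fset var}) :
  (finsupp m `<=` d)%fset -> wdeg w m = (\sum_(v <- d) w v * m v)%N.
Proof.
move=> sd; rewrite /wdeg; apply: big_fset_incl => // v _.
by rewrite -cmE_eq0 => /eqP ->; rewrite muln0.
Qed.

Lemma wdegM w m m' : wdeg w (m ** m') = (wdeg w m + wdeg w m')%N.
Proof.
rewrite {1}/wdeg mdomD (wdegEw w (fsubsetUl (finsupp m) (finsupp m'))).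
rewrite (wdegEw w (fsubsetUr (finsupp m) (finsupp m'))) -big_split /=.
by apply: eq_bigr => v _; rewrite cmM mulnDr.
Qed.

Lemma wdeg1 w : wdeg w m1 = 0%N.
Proof. by rewrite /wdeg mdom1 big_seq_fset0. Qed.

Lemma wdegU w v : wdeg w (ucm v) = w v.
Proof. by rewrite /wdeg mdomU big_seq_fset1 cmUU muln1. Qed.

Lemma wdegDw w w' m : wdeg (fun v => (w v + w' v)%N) m = (wdeg w m + wdeg w' m)%N.
Proof. by rewrite -big_split /=; apply: eq_bigr => v _; rewrite mulnDl. Qed.

Lemma eq_wdeg w w' m : {in finsupp m, w =1 w'} -> wdeg w m = wdeg w' m.
Proof.
by move=> e; rewrite /wdeg; apply: eq_big_seq => v /e ->.
Qed.

Lemma eq_wdegT w w' m : w =1 w' -> wdeg w m = wdeg w' m.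
Proof. by move=> e; apply: eq_wdeg => v _. Qed.

Lemma wdeg_coord v m : wdeg (fun v' => (v' == v) : nat) m = m v.
Proof.
rewrite (@wdegEw _ m (v |` finsupp m)%fset) ?fsubsetUr //.
rewrite (big_fsetD1 v) ?fset1U1 //= eqxx mul1n big1_fset ?addn0 // => v'.
by rewrite in_fsetD1 => /andP[/negbTE-> _].
Qed.

Lemma leq_wdeg w w' m : (forall v, w v <= w' v)%N -> (wdeg w m <= wdeg w' m)%N.
Proof. by move=> h; apply: leq_sum => v _; rewrite leq_mul2r h orbT. Qed.

Lemma mdeg_wdeg m : mdeg m = wdeg (fun=> 1%N) m.
Proof. by apply: eq_bigr => v _; rewrite mul1n. Qed.

Definition upow (v : var) (e : nat) : mon := iter e (mmul (ucm v)) m1.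

Lemma upowS v e : upow v e.+1 = ucm v ** upow v e. Proof. by []. Qed.

Lemma upowE v e v' : upow v e v' = ((v == v') * e)%N.
Proof.
elim: e => [|e IH]; first by rewrite muln0 cm1.
by rewrite upowS cmM cmU IH mulnS.
Qed.

Lemma wdeg_upow w v e : wdeg w (upow v e) = (e * w v)%N.
Proof.
elim: e => [|e IH]; first by rewrite wdeg1.
by rewrite upowS wdegM wdegU IH mulSn.
Qed.

Definition renm (g : var -> var) m : mon :=
  \big[mmul/m1]_(v <- finsupp m) upow (g v) (m v).

Lemma wdeg_prod (T : Type) (r : seq T) w (F : T -> mon) :
  wdeg w (\big[mmul/m1]_(i <- r) F i) = (\sum_(i <- r) wdeg w (F i))%N.
Proof. by apply: (big_morph _ (wdegM w) (wdeg1 w)). Qed.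

Lemma wdeg_renm w g m : wdeg w (renm g m) = wdeg (w \o g) m.
Proof.
by rewrite wdeg_prod; apply: eq_bigr => v _; rewrite wdeg_upow mulnC.
Qed.

Lemma renmE g m v : renm g m v = wdeg (fun v' => (g v' == v) : nat) m.
Proof. by rewrite -wdeg_coord wdeg_renm. Qed.

Lemma renmM g m m' : renm g (m ** m') = renm g m ** renm g m'.
Proof. by apply/eqP/cmP => v; rewrite cmM !renmE wdegM. Qed.

Lemma renm_upow g v e : renm g (upow v e) = upow (g v) e.
Proof. by apply/eqP/cmP => v'; rewrite renmE wdeg_upow upowE mulnC. Qed.

Lemma eq_renm g g' m : {in finsupp m, g =1 g'} -> renm g m = renm g' m.
Proof. by move=> e; rewrite /renm; apply: eq_big_seq => v /e ->. Qed.

Lemma renm_id g m : {in finsupp m, forall v, g v = v} -> renm g m = m.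
Proof.
move=> e; rewrite (eq_renm (g' := id) e); apply/eqP/cmP => v.
by rewrite renmE wdeg_coord.
Qed.

Lemma malgUM m m' : (<< m ** m' >> : XTPoly) = << m >> * << m' >>.
Proof. by rewrite malgM_def fgmulUU mulr1. Qed.

Lemma malg_upow v e : (<< upow v e >> : XTPoly) = mono v ^+ e.
Proof.
elim: e => [|e IH]; first by rewrite expr0.
by rewrite upowS malgUM IH exprS.
Qed.

Lemma malg_prod (T : Type) (r : seq T) (F : T -> mon) :
  (<< \big[mmul/m1]_(i <- r) F i >> : XTPoly) = \prod_(i <- r) << F i >>.
Proof. by apply: (big_morph (fun m => << m >> : XTPoly) malgUM (erefl _)). Qed.

Definition mev (s : var -> XTPoly) m : XTPoly := \prod_(v <- finsupp m) s v ^+ m v.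

Lemma mevEw s m (d : {fset var}) :
  (finsupp m `<=` d)%fset -> mev s m = \prod_(v <- d) s v ^+ m v.
Proof.
move=> sd; rewrite /mev; apply: big_fset_incl => // v _.
by rewrite -cmE_eq0 => /eqP ->; rewrite expr0.
Qed.

Lemma mev_is_mmorphism s : mmorphism (mev s).
Proof.
split=> [m m'|]; last by rewrite /mev mdom1 big_seq_fset0.
rewrite {1}/mev mdomD (mevEw s (fsubsetUl (finsupp m) (finsupp m'))).
rewrite (mevEw s (fsubsetUr (finsupp m) (finsupp m'))) -big_split /=.
by apply: eq_bigr => v _; rewrite cmM exprD.
Qed.

HB.instance Definition _ s := isMultiplicative.Build mon XTPoly (mev s) (mev_is_mmorphism s).

Lemma psubstE s p : psubst s p = mmap malgC (mev s) p.
Proof. by []. Qed.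

Lemma psubstM s p p' : psubst s (p * p') = psubst s p * psubst s p'.
Proof. by rewrite !psubstE rmorphM. Qed.

Lemma mcoeff_psubst s p m :
  (psubst s p)@_m = \sum_(k <- msupp p) p@_k * (mev s k)@_m.
Proof. by rewrite /psubst raddf_sum; apply: eq_bigr => k _ /=; rewrite mcoeffCM. Qed.

Definition ren (g : var -> var) : XTPoly -> XTPoly := psubst (fun v => mono (g v)).

Lemma mev_mono g m : mev (fun v => mono (g v)) m = << renm g m >>.
Proof. by rewrite malg_prod; apply: eq_bigr => v _; rewrite malg_upow. Qed.

Lemma mcoeff_ren g p m : (ren g p)@_m = \sum_(k <- msupp p | renm g k == m) p@_k.
Proof.
rewrite mcoeff_psubst [RHS]big_mkcond; apply: eq_bigr => k _ /=.
by rewrite mev_mono mcoeffU1; case: eqP; rewrite ?mulr1 ?mulr0.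
Qed.

Lemma mcoeff_ren1 g p m k0 : renm g k0 = m ->
  {in msupp p, forall k, renm g k = m -> k = k0} -> (ren g p)@_m = p@_k0.
Proof.
move=> e h; rewrite mcoeff_ren.
have [k0p|k0p] := boolP (k0 \in msupp p).
  rewrite big_mkcond (big_fsetD1 k0) //= e eqxx big1_fset ?addr0 // => k.
  rewrite !inE => /andP[nk /h{}h] _; case: eqP => // /h ke.
  by rewrite ke eqxx in nk.
rewrite (mcoeff_outdom k0p) big_seq_cond big1 // => k /andP[kp /eqP /(h _ kp)] ke.
by rewrite ke (negbTE k0p) in kp.
Qed.

Lemma mcoeff_ren0 g p m : {in msupp p, forall k, renm g k <> m} -> (ren g p)@_m = 0.
Proof.
move=> h; rewrite mcoeff_ren big_seq_cond big1 // => k /andP[kp /eqP].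
by move/(h _ kp).
Qed.

Lemma ren_id g p :
  (forall k, k \in msupp p -> forall v, v \in finsupp k -> g v = v) -> ren g p = p.
Proof.
move=> h; apply/malgP => m; have [mp|mp] := boolP (m \in msupp p).
  apply: mcoeff_ren1; first by apply: renm_id => v; apply: h mp v.
  by move=> k kp; rewrite renm_id // => v; apply: h kp v.
rewrite (mcoeff_outdom mp); apply: mcoeff_ren0 => k kp.
by rewrite renm_id => [e|v]; [rewrite -e kp in mp | apply: h kp v].
Qed.

Lemma eq_psubst s s' p : s =1 s' -> psubst s p = psubst s' p.
Proof.
move=> e; have ev m : mev s m = mev s' m by apply: eq_bigr => v _; rewrite e.
by apply/malgP => m; rewrite [LHS]mcoeff_psubst [RHS]mcoeff_psubst;
  apply: eq_bigr => k _; rewrite ev.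
Qed.

Lemma mcoeffUM m p m' : (<< m >> * p)@_(m ** m') = p@_m'.
Proof.
rewrite mcoeffMl msuppU1 big_seq_fset1 mcoeffUU.
have inj k : (m ** k == m ** m') = (k == m').
  apply/eqP/eqP => [e|-> //]; apply/eqP/cmP => v.
  by move/eqP/cmP/(_ v): e; rewrite !cmM => /addnI.
have [m'p|m'p] := boolP (m' \in msupp p).
  rewrite (big_fsetD1 m') //= eqxx mul1r big1_fset ?addr0 // => k.
  by rewrite !inE inj => /andP[/negbTE-> _] _.
rewrite (mcoeff_outdom m'p) big_seq big1 // => k kp; rewrite inj.
by case: eqP => // ke; rewrite ke (negbTE m'p) in kp.
Qed.

Lemma mcoeffUM0 m p (k : mon) v : (k v < m v)%N -> (<< m >> * p)@_k = 0.
Proof.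
move=> lt; rewrite mcoeffMl msuppU1 big_seq_fset1 big1 // => k' _.
by case: eqP => // /eqP/cmP/(_ v); rewrite cmM; lia.
Qed.

Lemma mcoeffM_suml p p' k : (p * p')@_k = \sum_(m <- msupp p) p@_m * (<< m >> * p')@_k.
Proof.
rewrite [LHS]mcoeffMl; apply: eq_bigr => m _.
rewrite mcoeffMl msuppU1 big_seq_fset1 mulr_sumr; apply: eq_bigr => k' _.
by rewrite mcoeffUU mul1r mulrnAr.
Qed.

(** * Equivariant quasisymmetry *)

(** All substitutions in use except t = 0 send variables to variables; these are the underlying
    maps. *)
Definition gplus k v : var := match v with
  | inl j => if (j <= k)%N then inl j else if j == k.+1 then inr k else inl j.-1
  | inr j => inr j end.
Definition gminus k v : var := match v with
  | inl j => if (j < k)%N then inl j else if j == k then inr k else inl j.-1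
  | inr j => inr j end.
Definition gthat k v : var := match v with
  | inl j => inl j | inr j => if (j < k)%N then inr j else inr j.+1 end.
Definition gxt v : var := match v with inl j => inr j | inr j => inr j end.

Lemma RplusE k p : Rplus k p = ren (gplus k) p.
Proof. by apply: eq_psubst => -[j|j] //=; case: ifP => // _; case: ifP. Qed.
Lemma RminusE k p : Rminus k p = ren (gminus k) p.
Proof. by apply: eq_psubst => -[j|j] //=; case: ifP => // _; case: ifP. Qed.
Lemma thatE k p : that k p = ren (gthat k) p.
Proof. by apply: eq_psubst => -[j|j] //=; case: ifP. Qed.
Lemma at_xtE p : at_xt p = ren gxt p.
Proof. by apply: eq_psubst => -[j|j]. Qed.

Definition tw v : nat := if v is inr _ then 1%N else 0%N.
Definition tdeg m : nat := wdeg tw m.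

Lemma leq_tdeg_mdeg m : (tdeg m <= mdeg m)%N.
Proof. by rewrite mdeg_wdeg; apply: leq_wdeg => -[]. Qed.

Lemma tdeg_supp v m : tdeg m = 0%N -> (0 < tw v)%N -> m v = 0%N.
Proof.
move=> td tv; have : (wdeg (fun v' => (v' == v) : nat) m <= tdeg m)%N.
  by apply: leq_wdeg => v'; case: eqP => // ->.
by rewrite wdeg_coord td leqn0 => /eqP.
Qed.

Lemma renm_coord g u m v : {in predC1 u &, injective g} -> m u = 0%N -> v != u ->
  renm g m (g v) = m v.
Proof.
move=> inj mu vu; rewrite renmE -[RHS]wdeg_coord; apply: eq_wdeg => v' v'm.
have v'u : v' != u by apply: contraTneq v'm => ->; rewrite -cmE_eq0 mu.
by congr nat_of_bool; apply/eqP/eqP => [/inj-> //|->].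
Qed.

(* The one variable [u] sent to a t-variable can only raise the t-degree, so nothing of lowest
   t-degree is lost or identified by the renaming. *)
Lemma mcoeff_ren_lead g u f r m :
  {in predC1 u &, injective g} -> (forall v, tw (g v) = (tw v + (v == u))%N) ->
  {in msupp f, forall k, (r <= tdeg k)%N} -> tdeg m = r -> m u = 0%N ->
  (ren g f)@_(renm g m) = f@_m.
Proof.
move=> inj tg lr tm mu.
have td k : tdeg (renm g k) = (tdeg k + k u)%N.
  by rewrite /tdeg wdeg_renm -(wdeg_coord u) -wdegDw; apply: eq_wdegT => v /=.
apply: mcoeff_ren1 => // k kf e; have ku : k u = 0%N.
  have := lr _ kf; have := congr1 tdeg e; rewrite !td mu tm; lia.
apply/eqP/cmP => v; have [->|vu] := eqVneq v u; first by rewrite ku mu.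
by rewrite -(renm_coord inj ku vu) e (renm_coord inj mu vu).
Qed.

Lemma inl_eqE (i j : nat) : (X i == X j) = (i == j). Proof. by []. Qed.

Lemma gplus_inj k : {in predC1 (X k.+1) &, injective (gplus k)}.
Proof.
move=> [j|j] [i|i]; rewrite !inE ?inl_eqE /=.
- by repeat (case: ifP => ?); move=> ? ? e; try lia; case: e => ?; congr inl; lia.
- by repeat (case: ifP => ?).
- by repeat (case: ifP => ?).
- by [].
Qed.

Lemma gminus_inj k : {in predC1 (X k) &, injective (gminus k)}.
Proof.
move=> [j|j] [i|i]; rewrite !inE ?inl_eqE /=.
- by repeat (case: ifP => ?); move=> ? ? e; try lia; case: e => ?; congr inl; lia.
- by repeat (case: ifP => ?).
- by repeat (case: ifP => ?).
- by [].
Qed.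

Lemma tw_gplus k v : tw (gplus k v) = (tw v + (v == X k.+1))%N.
Proof.
case: v => j //=; rewrite ?inl_eqE.
by case: ifP => h; [case: eqP h => // ->; rewrite ltnn | case: ifP].
Qed.

Lemma tw_gminus k v : tw (gminus k v) = (tw v + (v == X k))%N.
Proof.
case: v => j //=; rewrite ?inl_eqE.
by case: ifP => h; [case: eqP h => // ->; rewrite ltnn | case: ifP].
Qed.

(* The exponent [e] slides over the zero exponent next to it. *)
Lemma EQSym_shift1 n f r k e m : EQSym n f -> (k.+1 < n)%N ->
  {in msupp f, forall k, (r <= tdeg k)%N} ->
  tdeg m = r -> m (X k) = 0%N -> m (X k.+1) = 0%N ->
  f@_(upow (X k) e ** m) = f@_(upow (X k.+1) e ** m).
Proof.
move=> [_ /(_ k)sym] /sym{sym}sym lr tm mk mk1.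
have tdX j : tdeg (upow (X j) e ** m) = r by rewrite /tdeg wdegM wdeg_upow muln0 -/(tdeg m) tm.
rewrite -(mcoeff_ren_lead (@gplus_inj k) (tw_gplus k) lr (tdX k)); last first.
  by rewrite cmM upowE mk1 inl_eqE (ltn_eqF (ltnSn k)).
rewrite -(mcoeff_ren_lead (@gminus_inj k) (tw_gminus k) lr (tdX k.+1)); last first.
  by rewrite cmM upowE mk inl_eqE (gtn_eqF (ltnSn k)).
rewrite -RplusE -RminusE sym; congr (mcoeff _ _).
(* The two renamings differ only at [X k] and [X k.+1], which [m] avoids. *)
have em : renm (gplus k) m = renm (gminus k) m.
  apply: eq_renm => -[j|j] jm; last exact: erefl.
  rewrite /gplus /gminus.
  have jk : j <> k by move=> jk; move: jm; rewrite jk -cmE_neq0 mk.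
  have jk1 : j <> k.+1 by move=> jk'; move: jm; rewrite jk' -cmE_neq0 mk1.
  clear -jk jk1; repeat (case: ifP => ?); done || lia.
rewrite [LHS]renmM [RHS]renmM em [in LHS]renm_upow [in RHS]renm_upow /= leqnn ltnNge leqnSn /=.
by rewrite (gtn_eqF (ltnSn k)).
Qed.

Lemma EQSym_shift n f r i j e m : EQSym n f -> (i <= j < n)%N ->
  {in msupp f, forall k, (r <= tdeg k)%N} ->
  tdeg m = r -> (forall l, (i <= l <= j)%N -> m (X l) = 0%N) ->
  f@_(upow (X i) e ** m) = f@_(upow (X j) e ** m).
Proof.
move=> fE + lr tm; elim: j => [|j IH] ij mX; first by have -> : i = 0%N by lia.
have [-> //|nij] := eqVneq i j.+1.
rewrite IH; [|by lia|by move=> l lij; apply: mX; lia].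
by apply: (EQSym_shift1 e fE _ lr tm); [lia|apply: mX; lia|apply: mX; lia].
Qed.

Lemma Rplus_id n f : in_Zt_x n.+1 f -> Rplus n f = f.
Proof.
move=> fx; rewrite RplusE; apply: ren_id => k kf [j|j] //= jk; case: leqP => // nj.
by move: jk; rewrite -cmE_neq0 fx.
Qed.

(** [gminus n] sends [X n] to [T n], and only [X n.+1], which does not occur in [f], to [X n]. *)
Lemma Rminus_coef0 n f m : in_Zt_x n.+1 f -> (0 < m (X n))%N -> (Rminus n f)@_m = 0.
Proof.
move=> fx mn; rewrite RminusE; apply: mcoeff_ren0 => k kf e.
move: mn; rewrite -e renmE (@eq_wdegT _ (fun v => (v == X n.+1) : nat)).
  by rewrite wdeg_coord fx.
move=> [j|j] //; rewrite inl_eqE /=; congr nat_of_bool.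
case: ifP => h; first by rewrite inl_eqE; apply/eqP/eqP; lia.
case: ifP => h'; first by rewrite (eqP h') (ltn_eqF (ltnSn n)).
by rewrite inl_eqE; apply/eqP/eqP; lia.
Qed.

(** [Rplus n] fixes [f] while [Rminus n f] is free of [X n]. *)
Lemma in_Zt_x_drop n f : in_Zt_x n.+1 f -> Rplus n f = Rminus n f -> in_Zt_x n f.
Proof.
move=> fx sym m mf j; rewrite leq_eqVlt => /predU1P[<-|nj]; last exact: fx.
apply/eqP; rewrite eqn0Ngt; apply/negP => mn.
by move: mf; rewrite -mcoeff_neq0 -(Rplus_id fx) sym Rminus_coef0.
Qed.

Lemma in_Zt_x_bound f : exists N, in_Zt_x N f.
Proof.
pose G (v : var) := if v is inl j then j.+1 else 0%N.
pose F m := (\max_(v <- finsupp m) G v)%N.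
exists (\max_(m <- msupp f) F m)%N => m mf j hj.
apply/eqP; rewrite cmE_eq0; apply/negP => jm.
have h1 := @leq_bigmax_seq _ _ xpredT F _ mf isT; have h2 := @leq_bigmax_seq _ _ xpredT G _ jm isT.
by have := leq_trans (leq_trans h2 h1) hj; rewrite ltnn.
Qed.

(** Only finitely many variables occur, and the largest is dropped repeatedly. This turns the
    vanishing of E_k for k >= n into a bound on the x-variables of a forest polynomial. *)
Lemma in_Zt_x_sym n f : (forall k, (n <= k)%N -> Rplus k f = Rminus k f) -> in_Zt_x n f.
Proof.
move=> sym; have [N fN] := in_Zt_x_bound f.
elim: N fN => [|N IH] fN; first by move=> m mf j _; apply: fN.
have [nN|Nn] := leqP n N; first by apply/IH/in_Zt_x_drop/sym.
by move=> m mf j nj; apply: (fN m mf) (leq_trans Nn nj).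
Qed.

(** * Monomials as words, and coefficients of E_n *)

Definition mword (w : seq nat) : mon := \big[mmul/m1]_(j <- w) ucm (X j).

Lemma mword_cons j w : mword (j :: w) = ucm (X j) ** mword w.
Proof. by rewrite /mword big_cons. Qed.

Lemma wdeg_mword wt w : wdeg wt (mword w) = (\sum_(j <- w) wt (X j))%N.
Proof. by rewrite wdeg_prod; apply: eq_bigr => j _; rewrite wdegU. Qed.

Lemma tdeg_mword w : tdeg (mword w) = 0%N.
Proof. by rewrite /tdeg wdeg_mword big1. Qed.

Lemma mwordX w j : mword w (X j) = count_mem j w.
Proof.
rewrite -wdeg_coord wdeg_mword -sum1_count [RHS]big_mkcond.
by apply: eq_bigr => i _; rewrite inl_eqE /=; case: eqP.
Qed.

Lemma mwordT w j : mword w (T j) = 0%N.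
Proof. by rewrite -wdeg_coord wdeg_mword big1. Qed.

Lemma mword_filter j w :
  mword w = upow (X j) (count_mem j w) ** mword [seq i <- w | i != j].
Proof.
apply/eqP/cmP => -[i|i]; rewrite cmM upowE ?mwordX ?mwordT // inl_eqE count_filter.
case: eqP => [<-|ji].
  rewrite mul1n -[LHS]addn0; congr addn; rewrite -(count_pred0 w).
  by apply: eq_count => i' /=; case: eqP.
apply: eq_count => i' /=; case: eqP => // ->; case: eqP => // ij; case: ji.
by rewrite ij.
Qed.

Lemma mcoeff_that k p m : tdeg m = 0%N -> (that k p)@_m = p@_m.
Proof.
move=> tm.
have rid m' : tdeg m' = 0%N -> renm (gthat k) m' = m'.
  move=> td; apply: renm_id => -[j|j] jm; first exact: erefl.
  by move: jm; rewrite -cmE_neq0 (tdeg_supp td).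
rewrite thatE; apply: mcoeff_ren1 => [|m' _ e]; first exact: rid.
rewrite -[m']rid //; rewrite -tm -e /tdeg wdeg_renm.
by apply: eq_wdegT => -[j|j] //=; case: ifP.
Qed.

Lemma mcoeffBM (a b c : XTPoly) (k : mon) : ((a - b) * c)@_k = (a * c)@_k - (b * c)@_k.
Proof. by rewrite mulrBl; apply: mcoeffB. Qed.

(** Compare coefficients of [ucm (X n) ** m] in (x_n - t_n) g = f - R_n^- f: the t_n term
    contributes nothing because [m] is t-free, and R_n^- f contains no x_n. *)
Lemma E_is_coef n f p m : in_Zt_x n.+1 f -> E_is n f (that n p) -> tdeg m = 0%N ->
  f@_(ucm (X n) ** m) = p@_m.
Proof.
move=> fx; rewrite /E_is (Rplus_id fx) => e tm.
pose k := ucm (X n) ** m.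
have h1 : (xx n * that n p)@_k = p@_m.
  by rewrite -(mcoeff_that n p tm); apply: mcoeffUM.
have h2 : (tt n * that n p)@_k = 0.
  by apply: (@mcoeffUM0 _ _ _ (T n)); rewrite cmM cmU cmUU (tdeg_supp tm).
have h3 : (Rminus n f)@_k = 0 by apply: Rminus_coef0 fx _; rewrite cmM cmUU.
have h4 := mcoeffBM (xx n) (tt n) (that n p) k.
have h5 := mcoeffB k f (Rminus n f).
move: h5; rewrite -e h3 subr0 -/k => <-.
by apply: (etrans h4); apply: (etrans (congr2 (fun a b => a - b) h1 h2)); apply: subr0.
Qed.

(** * Coefficients of t-degree 0 of double forest polynomials *)

Section Family.
Variables (P : forest -> XTPoly) (hP : double_forest_family P).

Lemma P_notdes F k : k \notin Qdes F -> Rplus k (P F) = Rminus k (P F).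
Proof.
case: hP => _ _ /(_ F k) + /negbTE kF; rewrite kF /E_is mulr0 => /esym/eqP.
by rewrite subr_eq0 => /eqP.
Qed.

Lemma cforest0 n : cforest n [::] = empty_forest.
Proof. exact: val_inj. Qed.

(** Every E_k vanishes on it, so no x-variable occurs and the substitution x = t, whose value is 1,
    changes nothing. *)
Lemma P_empty : P empty_forest = 1.
Proof.
case: hP => _ /(_ empty_forest) /= e _; rewrite -e at_xtE ren_id // => k kf [j|j] // jk.
have : in_Zt_x 0 (P empty_forest) by apply: in_Zt_x_sym => i _; apply: P_notdes.
by move=> /(_ k kf j isT) /eqP; rewrite cmE_eq0 jk.
Qed.

(** The substitution x = t preserves total degree, hence the constant coefficient. *)
Lemma P_const F : (P F)@_m1 = (sval F == [::])%:R.
Proof.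
case: hP => _ /(_ F) e _; transitivity ((at_xt (P F))@_m1).
  rewrite at_xtE; apply/esym/mcoeff_ren1 => [|k _ ek].
    by apply/eqP/cmP => v; rewrite renmE wdeg1 cm1.
  by apply: mdeg_eq0I; rewrite -(mdeg1 (I := var)) -ek !mdeg_wdeg wdeg_renm.
by rewrite e; case: ifP => _; rewrite ?mcoeff0 // mcoeffUU.
Qed.

(** The only possible descent is [n.-1]: vanishing of E_k above it bounds the x-variables, and below
    it gives the symmetry. *)
Lemma P_EQSym n ra : rcomp n ra -> EQSym n (P (cforest n ra)).
Proof.
case: ra => [|x ra] /andP[pos sz].
  rewrite cforest0; split=> [|k kn]; last by apply: P_notdes.
  by apply: in_Zt_x_sym => k _; apply: P_notdes.
split=> [|k kn].
  apply: in_Zt_x_sym => k nk; apply: P_notdes.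
  by rewrite Qdes_cforest // inE; apply/eqP => e; move: sz nk => /=; rewrite e; lia.
by apply: P_notdes; rewrite Qdes_cforest // inE; apply/eqP => e; move: kn; rewrite e; lia.
Qed.

Lemma P_peel n x ra m : rcomp n (x :: ra) -> tdeg m = 0%N ->
  (P (cforest n (x :: ra)))@_(ucm (X n.-1) ** m) =
  (P (if x == 1 then cforest n.-1 ra else cforest n (x.-1 :: ra)))@_m.
Proof.
move=> hv tm; have [fx _] := P_EQSym hv; case/andP: (hv) => pos sz.
case: hP => _ _ /(_ (cforest n (x :: ra)) n.-1).
rewrite Qdes_cforest // inE eqxx fquot_cforest // => e.
apply: E_is_coef _ e tm.
by move: fx; have -> : n = n.-1.+1 by case: (n) sz.
Qed.

(* Slide the largest letter to position n.-1, peel it off, and slide the rest back. *)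
Lemma P_coef n ra w : rcomp n ra -> sorted geq w -> all (fun j => (j < n)%N) w ->
  (P (cforest n ra))@_(mword w) = (word_ok ra w)%:R.
Proof.
elim: w n ra => [|j w IH] n ra hv.
  move=> _ _; rewrite /mword big_nil P_const.
  by case: ra hv => //= x ra _; rewrite -size_eq0 size_rcons.
have tr : transitive geq by move=> a b c /= ba cb; apply: leq_trans cb ba.
rewrite /= path_sortedE // => /andP[wj sw] /andP[jn wn].
case: ra hv => [|x ra] hv.
  by rewrite cforest0 P_empty mcoeff1 mword_cons cmM_eq1 cm1_eq1.
have wjE i : i \in [seq i <- w | i != j] -> (i < j)%N.
  by rewrite mem_filter ltn_neqAle => /andP[-> /(allP wj)].
set m' := mword [seq i <- w | i != j]; set e := count_mem j w.
have m'0 l : (j <= l <= n.-1)%N -> m' (X l) = 0%N.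
  move=> /andP[jl _]; rewrite /m' mwordX; apply/count_memPn/negP => /wjE.
  by rewrite ltnNge jl.
have tm' : tdeg m' = 0%N by apply: tdeg_mword.
have jn1 : (j <= n.-1 < n)%N by case: (n) jn => //= k; rewrite ltnS ltnSn andbT.
have mE : mword (j :: w) = upow (X j) e.+1 ** m'.
  by rewrite mword_cons (mword_filter j w) upowS mulmA.
have lr0 p : {in msupp p, forall k : mon, (0 <= tdeg k)%N} by [].
rewrite mE (EQSym_shift _ (P_EQSym hv) jn1 (lr0 _) tm' m'0) upowS -mulmA P_peel //; last first.
  by rewrite /tdeg wdegM wdeg_upow muln0 add0n.
rewrite word_ok_cons; case/andP: (hv) => /= /andP[x0 pos] sz.
have [x1|x1] := eqVneq x 1%N.
  rewrite x1 /=; have hv' : rcomp n.-1 ra by rewrite /rcomp pos; case: (n) sz.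
  have [e0|e0] := posnP e.
    have wE : [seq i <- w | i != j] = w.
      by apply/all_filterP; rewrite all_predC has_pred1; apply/count_memPn.
    rewrite e0 /upow /= mul1m /m' wE IH //; last first.
      by apply/allP => i; rewrite -wE => /wjE ij; case/andP: jn1 => + _; apply: leq_trans.
    case: w wE {IH sw wn m' m'0 tm' mE e e0 wj} wjE => [|h w] wE wjE; first by rewrite andbT.
    by rewrite wjE ?wE ?mem_head // andbT.
  (* Another letter equal to [j] remains: it violates the strict descent, and [X n.-1] cannot occur
     in a polynomial in n - 1 variables, so both sides vanish. *)
  rewrite mcoeff_outdom.
    have : j \in w by rewrite -has_pred1 has_count.
    case: w wj sw {IH wn wjE m' m'0 tm' e e0 mE} => // h w /= /andP[hj _].
    rewrite path_sortedE // => /andP[/allP hw _]; rewrite inE => /predU1P[<-|/hw /= jh].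
      by rewrite ltnn andbF.
    by rewrite ltnNge jh andbF.
  have [fx _] := P_EQSym hv'; apply/negP => /fx /(_ n.-1 (leqnn _)) /eqP.
  by rewrite cmM upowE eqxx mul1n addn_eq0; case: (e) e0.
have x2 : (1 < x)%N by case: x x0 x1 {hv sz} => [|[|]].
have hv' : rcomp n (x.-1 :: ra) by rewrite /rcomp /= pos sz andbT; case: (x) x2 => [|[|]].
(* The last part stays positive, so the length is still [n] and the [e] remaining copies slide back
   from [n.-1] to [j]. *)
rewrite -(EQSym_shift _ (P_EQSym hv') jn1 (lr0 _) tm' m'0) -mword_filter IH // leqNgt x2 /=.
by case: w wj {IH sw wn wjE m' m'0 tm' e mE} => [|h w];
  rewrite ?andbT //= => /andP[-> _]; rewrite andbT.
Qed.

End Family.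

Lemma mcoeff_sum (I : Type) (r : seq I) (Q : pred I) (F : I -> XTPoly) (k : mon) :
  (\sum_(i <- r | Q i) F i)@_k = \sum_(i <- r | Q i) (F i)@_k.
Proof. exact: raddf_sum. Qed.

Lemma tdeg_eq0P m : reflect (forall v, v \in finsupp m -> tw v = 0%N) (tdeg m == 0%N).
Proof.
apply: (iffP eqP) => [td v vm|h].
  apply/eqP; rewrite eqn0Ngt; apply/negP => tv.
  by move: vm; rewrite -cmE_neq0 (tdeg_supp td tv).
by rewrite /tdeg (eq_wdeg (w' := fun=> 0%N)) // /wdeg big1.
Qed.

(** * Specialization at t = 0 *)

Definition st0 v : XTPoly := match v with inl j => xx j | inr j => 0 end.

Lemma mev_st0 m : mev st0 m = if tdeg m == 0%N then << m >> else 0.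
Proof.
case: tdeg_eq0P => [h|h].
  rewrite -[in RHS](@renm_id id m) // -mev_mono; apply: eq_big_seq => v /h.
  by case: v => [j|j] tv; [exact: erefl|discriminate tv].
have [h'|] := boolP (all (fun v => tw v == 0%N) (finsupp m)).
  by case: h => v vm; apply/eqP; apply: (allP h').
case/allPn => -[j|j] vm // _; rewrite /mev (big_fsetD1 (T j)) //=.
by move: vm; rewrite -cmE_neq0 expr0n => /negbTE ->; rewrite mul0r.
Qed.

Lemma mcoeff_at_t0 p m : (at_t0 p)@_m = if tdeg m == 0%N then p@_m else 0.
Proof.
rewrite /at_t0 mcoeff_psubst.
have E k : (mev st0 k)@_m = ((tdeg m == 0%N) && (k == m))%:R.
  rewrite mev_st0; have [->|km] := eqVneq k m.
    by rewrite andbT; case: ifP; rewrite ?mcoeff0 // mcoeffUU.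
  by rewrite andbF; case: ifP; rewrite ?mcoeff0 // mcoeffU1 (negbTE km).
transitivity (\sum_(k <- msupp p) p@_k * ((tdeg m == 0%N) && (k == m))%:R).
  by apply: eq_bigr => k _; rewrite -E.
case: ifP => _ /=; last by rewrite big1 // => k _; rewrite mulr0.
have [mp|mp] := boolP (m \in msupp p).
  rewrite (big_fsetD1 m) //= eqxx mulr1 big1_fset ?addr0 // => k.
  by rewrite !inE => /andP[/negbTE-> _]; rewrite mulr0.
rewrite (mcoeff_outdom mp) big_seq big1 // => k kp.
by case: eqP => [e|_]; rewrite ?mulr0 //; rewrite -e kp in mp.
Qed.

Fixpoint xword (n : nat) m : seq nat :=
  if n is n'.+1 then nseq (m (X n')) n' ++ xword n' m else [::].

Lemma count_xword n m j : count_mem j (xword n m) = if (j < n)%N then m (X j) else 0%N.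
Proof.
elim: n => //= n IH; rewrite count_cat count_nseq IH ltnS /=.
by case: ltngtP => [jn|jn|->]; rewrite ?mul1n ?addn0.
Qed.

Lemma xword_bound n m : all (fun j => (j < n)%N) (xword n m).
Proof.
elim: n => //= n IH; rewrite all_cat all_nseq ltnSn orbT /=.
by apply: sub_all IH => j /ltnW.
Qed.

Lemma geq_trans : transitive geq.
Proof. by move=> a b c /= ba cb; apply: leq_trans cb ba. Qed.

Lemma xword_sorted n m : sorted geq (xword n m).
Proof.
elim: n => //= n IH; rewrite (sorted_pairwise geq_trans) pairwise_cat.
rewrite -!(sorted_pairwise geq_trans) IH andbT; apply/andP; split.
  apply/allrelP => i j /nseqP[-> _] /(allP (xword_bound n m)); exact: ltnW.
by elim: (m (X n)) => //= -[|x] //= ->; rewrite leqnn.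
Qed.

Lemma mword_xword n m : tdeg m = 0%N -> (forall j, (n <= j)%N -> m (X j) = 0%N) ->
  mword (xword n m) = m.
Proof.
move=> td mx; apply/eqP/cmP => -[j|j]; last by rewrite mwordT (tdeg_supp td).
by rewrite mwordX count_xword; case: ltnP => // /mx ->.
Qed.

Lemma mword_inj w w' : sorted geq w -> sorted geq w' -> mword w = mword w' -> w = w'.
Proof.
move=> sw sw' e; apply: (sorted_eq geq_trans _ sw sw').
  by move=> i j /=; rewrite andbC => /anti_leq.
by apply/allP => j _ /=; rewrite -!mwordX e.
Qed.

Lemma seq_ord n w : all (fun j => (j < n)%N) w -> exists s : seq 'I_n, map val s = w.
Proof.
elim: w => [_|j w IH /= /andP[jn /IH[s <-]]]; first by exists [::].
by exists (Ordinal jn :: s).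
Qed.

Lemma fqs_ok_sorted D s : fqs_ok D s -> sorted leq s.
Proof.
move=> h; apply/(sortedP 0%N) => i si.
have := allP h i.+1; rewrite mem_iota => /(_ _)/andP[]; last by [].
by case: s si {h} => //=; lia.
Qed.

(** A weakly increasing tuple is determined by its monomial, so only [rev w] can contribute. *)
Lemma mcoeff_fundamental n ra w : all (leq 1) ra -> sorted geq w ->
  all (fun j => (j < n)%N) w ->
  (fundamental n (nseq (n - size ra) 0%N ++ rev ra))@_(mword w) = (word_ok ra w)%:R.
Proof.
move=> pos sw wn; rewrite /fundamental.
have -> : comp_of (nseq (n - size ra) 0%N ++ rev ra) = rev ra.
  rewrite /comp_of filter_cat (_ : [seq x <- nseq _ _ | _] = [::]); last first.
    by apply/eqP; rewrite -size_eq0 size_filter count_nseq.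
  by apply/all_filterP; rewrite all_rev.
rewrite word_ok_fqs // mcoeff_sum; set a := rev ra.
have E (t : (sumn a).-tuple 'I_n) : fqs_ok (descset a) (map val t) ->
    (\prod_(i <- t) xx (val i))@_(mword w) = (map val t == rev w)%:R.
  move=> /fqs_ok_sorted st.
  have -> : \prod_(i <- t) xx (val i) = << mword (map val t) >> :> XTPoly.
    by rewrite malg_prod big_map.
  rewrite mcoeffU1; congr (nat_of_bool _)%:R; apply/eqP/eqP => [e|->].
    apply: (can_inj revK); rewrite revK; apply: mword_inj sw _; first by rewrite rev_sorted.
    rewrite -e; apply/eqP/cmP => -[i|i]; rewrite ?mwordX ?mwordT //.
    by rewrite count_rev.
  by apply/eqP/cmP => -[i|i]; rewrite ?mwordX ?mwordT // count_rev.
rewrite (eq_bigr _ E).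
have [sz|sz] := eqVneq (size w) (sumn a); last first.
  rewrite big1 // => t _; case: eqP => // /(congr1 size).
  by rewrite size_map size_tuple size_rev => e; rewrite e eqxx in sz.
have wn' : all (fun j => (j < n)%N) (rev w) by rewrite all_rev.
have [s es] := seq_ord wn'.
have ss : size s == sumn a by rewrite -sz -(size_rev w) -es size_map.
pose t0 := Tuple ss.
have U (t : (sumn a).-tuple 'I_n) : (map val t == rev w) = (t == t0).
  rewrite -es; apply/eqP/eqP => [/(inj_map val_inj) e|-> //].
  exact: val_inj.
case: (boolP (fqs_ok (descset a) (rev w))) => ok /=.
  rewrite (bigD1 t0) /=; last by rewrite es.
  rewrite es eqxx big1 ?addr0 // => t /andP[_ /negbTE]; rewrite U => -> //.
rewrite big1 // => t okt; case: eqP => // e.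
by rewrite e (negbTE ok) in okt.
Qed.

Section Family.
Variables (P : forest -> XTPoly) (hP : double_forest_family P).

(** Both sides are supported on t-free monomials in the first [n] variables, where both coefficients
    are given by [word_ok]. *)
Lemma P_at_t0 n ra : rcomp n ra ->
  at_t0 (P (cforest n ra)) = fundamental n (nseq (n - size ra) 0%N ++ rev ra).
Proof.
move=> hv; case/andP: (hv) => pos sz; apply/malgP => m.
have [fx _] := P_EQSym hP hv.
have [<-|nm] := eqVneq (mword (xword n m)) m.
  rewrite mcoeff_at_t0 tdeg_mword eqxx (P_coef hP) ?xword_sorted ?xword_bound //.
  by rewrite mcoeff_fundamental ?xword_sorted ?xword_bound.
transitivity (0 : int).
  rewrite mcoeff_at_t0; case: eqP => // td; apply: mcoeff_outdom.
  by apply: contraNN nm => /fx mx; rewrite mword_xword.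
rewrite /fundamental mcoeff_sum big1 // => t _.
have -> : \prod_(i <- t) xx (val i) = << mword (map val t) >> :> XTPoly.
  by rewrite malg_prod big_map.
rewrite mcoeffU1; case: eqP => // e; move: nm; rewrite -e mword_xword ?eqxx ?tdeg_mword //.
move=> j nj; rewrite mwordX; apply/count_memPn/mapP => -[i _ ji].
by move: nj; rewrite ji leqNgt ltn_ord.
Qed.

End Family.

(** * Triangularity and the basis *)

Definition tmon m := all (fun v => tw v == 1%N) (finsupp m).

Lemma tmonX m j : tmon m -> m (X j) = 0%N.
Proof.
by move=> /allP h; apply/eqP; rewrite cmE_eq0; apply/negP => /h.
Qed.

Lemma in_Zt_tmon a m : in_Zt a -> m \in msupp a -> tmon m.
Proof.
move=> ha ma; apply/allP => -[j|j] jm //.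
by move: jm; rewrite -cmE_neq0 (ha m ma j isT).
Qed.

Lemma mulcm_divcm m m' : (forall v, (m' v <= m v)%N) -> m' ** divcm m m' = m.
Proof. by move=> h; apply/eqP/cmP => v; rewrite cmM divcmE subnKC. Qed.

(** Otherwise [c] divides [b] with a quotient of t-degree 0, forcing equality. The exponent found
    prevents [c] from dividing [b] times an x-word. *)
Lemma tmon_lead b c : tmon b -> tmon c -> (tdeg b <= tdeg c)%N -> b != c ->
  exists j, (b (T j) < c (T j))%N.
Proof.
move=> tb tc le nbc.
have [/hasP[[j|j] jc lt]|/hasPn h] := boolP (has (fun v => (b v < c v)%N) (finsupp c)).
- by rewrite (tmonX _ tc) in lt.
- by exists j.
have cb v : (c v <= b v)%N.
  have [/h|] := boolP (v \in finsupp c); first by rewrite -leqNgt.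
  by rewrite -cmE_eq0 => /eqP ->.
have bE := mulcm_divcm cb.
have td : tdeg (divcm b c) = 0%N.
  by move: le; rewrite -{1}bE /tdeg wdegM -/(tdeg c) -/(tdeg _); lia.
case/eqP: nbc; apply/eqP/cmP => -[j|j]; first by rewrite !tmonX.
by rewrite -bE cmM (tdeg_supp td) ?addn0.
Qed.

(** By [tmon_lead], no monomial of [a] other than [b] divides [b ** mword w]. *)
Lemma mcoeff_lead a p b w r : in_Zt a -> {in msupp a, forall k, (r <= tdeg k)%N} ->
  tmon b -> tdeg b = r -> (a * p)@_(b ** mword w) = a@_b * p@_(mword w).
Proof.
move=> ha ar tb br; rewrite [LHS]mcoeffM_suml.
have Z c : c \in msupp a -> c != b -> (<< c >> * p)@_(b ** mword w) = 0.
  move=> ca ncb; have tc := in_Zt_tmon ha ca.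
  have le : (tdeg b <= tdeg c)%N by rewrite br ar.
  have [|j lt] := tmon_lead tb tc le; first by rewrite eq_sym.
  by apply: (@mcoeffUM0 _ _ _ (T j)); rewrite cmM mwordT addn0.
have [ba|ba] := boolP (b \in msupp a).
  rewrite (big_fsetD1 b) //= [Y in _ * Y + _]mcoeffUM big1_fset ?addr0 // => c.
  by rewrite !inE => /andP[nc ca] _; rewrite (Z _ ca nc) mulr0.
rewrite (mcoeff_outdom ba) mul0r big_seq big1 // => c ca; rewrite (Z _ ca) ?mulr0 //.
by apply: contraNneq ba => <-.
Qed.

(** * Supports, and EQSym_n as a Z[t]-module *)

Definition suppin (Q : mon -> Prop) p := forall m, m \in msupp p -> Q m.

Lemma suppin0 Q : suppin Q 0.
Proof. by move=> m; rewrite msupp0 inE. Qed.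

Lemma suppinD Q p p' : suppin Q p -> suppin Q p' -> suppin Q (p + p').
Proof.
by move=> hp hp' m /(fsubsetP (msuppD_le _ _)); rewrite inE => /orP[/hp|/hp'].
Qed.

Lemma suppinB Q p p' : suppin Q p -> suppin Q p' -> suppin Q (p - p').
Proof.
by move=> hp hp' m /(fsubsetP (msuppB_le _ _)); rewrite inE => /orP[/hp|/hp'].
Qed.

Lemma suppin_sum Q (I : eqType) (r : seq I) (F : I -> XTPoly) :
  (forall i, i \in r -> suppin Q (F i)) -> suppin Q (\sum_(i <- r) F i).
Proof.
move=> h; rewrite big_seq; apply: (big_ind (suppin Q)) => //; [exact: suppin0|].
by move=> p p'; apply: suppinD.
Qed.

Lemma suppinM (Q Qa Qp : mon -> Prop) a p : suppin Qa a -> suppin Qp p ->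
  (forall m m', Qa m -> Qp m' -> Q (m ** m')) -> suppin Q (a * p).
Proof.
move=> ha hp h m /msuppM_le[c [k [ca kp ->]]]; apply: h; [exact: ha|exact: hp].
Qed.

Lemma in_Zt_xM n a p : in_Zt a -> in_Zt_x n p -> in_Zt_x n (a * p).
Proof.
move=> ha hp; apply: (suppinM ha hp) => m m' hm hm' j nj.
by rewrite cmM hm // hm'.
Qed.

Lemma in_Zt_U c b : tmon b -> in_Zt << c *g b >>.
Proof.
move=> tb m /(fsubsetP msuppU_le); rewrite inE => /eqP -> j _; exact: tmonX.
Qed.

Lemma ren_Zt g a : (forall j, g (T j) = T j) -> in_Zt a -> ren g a = a.
Proof.
move=> gT ha; apply: ren_id => k ka [j|j] jk //.
by move: jk; rewrite -cmE_neq0 (ha k ka j isT).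
Qed.

Lemma EQSymM n a p : in_Zt a -> EQSym n p -> EQSym n (a * p).
Proof.
move=> ha [px sym]; split=> [|k kn]; first exact: in_Zt_xM.
have e := sym _ kn; rewrite RplusE RminusE in e; rewrite RplusE RminusE.
have h g : (forall j, g (T j) = T j) -> ren g (a * p) = a * ren g p.
  by move=> gT; rewrite -{2}(ren_Zt gT ha); apply: psubstM.
have hp := h (gplus k) (fun=> erefl); have hm := h (gminus k) (fun=> erefl).
exact (etrans hp (etrans (congr1 (fun q => a * q) e) (esym hm))).
Qed.

Lemma EQSymD n p p' : EQSym n p -> EQSym n p' -> EQSym n (p + p').
Proof.
move=> [px sym] [px' sym']; split=> [|k kn]; first exact: suppinD.
have e := sym _ kn; have e' := sym' _ kn.
have D s : psubst s (p + p') = psubst s p + psubst s p' by rewrite !psubstE raddfD.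
exact (etrans (D _) (etrans (congr2 +%R e e') (esym (D _)))).
Qed.

Lemma EQSymB n p p' : EQSym n p -> EQSym n p' -> EQSym n (p - p').
Proof.
move=> hp hp'; apply: EQSymD hp _; rewrite -mulN1r; apply: EQSymM hp'.
have -> : (-1 : XTPoly) = << -1 *g m1 >> by rewrite monalgUN.
by apply: in_Zt_U; rewrite /tmon mdom1.
Qed.

Lemma EQSym0 n : EQSym n 0.
Proof.
split=> [|k _]; first exact: suppin0.
have Z s : psubst s 0 = 0 by rewrite /psubst msupp0 big_seq_fset0.
exact (etrans (Z _) (esym (Z _))).
Qed.

Lemma EQSym_sum n (I : eqType) (r : seq I) (F : I -> XTPoly) :
  (forall i, i \in r -> EQSym n (F i)) -> EQSym n (\sum_(i <- r) F i).
Proof.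
move=> h; rewrite big_seq; apply: (big_ind (EQSym n)); last exact: h.
  exact: EQSym0.
by move=> p p'; apply: EQSymD.
Qed.

Lemma xword_nil n m : (forall k, (k.+1 < n)%N -> m (X k.+1) = 0%N -> m (X k) = 0%N) ->
  ((0 < n)%N -> m (X n.-1) = 0%N) -> xword n m = [::].
Proof.
elim: n => //= n IH h /(_ isT) e; rewrite e /=; apply: IH => [k kn|].
  by apply: h; apply: ltnW.
by case: n h e => // n h e _; apply: h.
Qed.

(** The hypothesis says that no exponent can slide right any more: reading down from [n.-1], a zero
    exponent is followed by zeros only. *)
Lemma xword_padded n m : (forall k, (k.+1 < n)%N -> m (X k.+1) = 0%N -> m (X k) = 0%N) ->
  exists2 ra, rcomp n ra & xword n m = cword n ra.
Proof.
elim: n => [|n IH] h; first by exists [::].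
have [e|x0] := posnP (m (X n)).
  by exists [::] => //; apply: xword_nil.
have [|ra /andP[pos sz] e] := IH; first by move=> k kn; apply: h; apply: ltnW.
exists (m (X n) :: ra); first by rewrite /rcomp /= x0 pos.
by rewrite /= e.
Qed.

(* Induction on a potential that drops each time an exponent slides to the right. *)
Lemma EQSym_key n f r : EQSym n f -> {in msupp f, forall k, (r <= tdeg k)%N} ->
  (forall b ra, tmon b -> tdeg b = r -> rcomp n ra -> f@_(b ** mword (cword n ra)) = 0) ->
  forall m, tdeg m = r -> f@_m = 0.
Proof.
move=> fE lr key m; have [fx _] := fE.
pose pot m := wdeg (fun v => if v is inl j then (n - j)%N else 0%N) m.
have [N] := ubnP (pot m); elim: N m => // N IH m; rewrite ltnS => potm tm.
have [mf|] := boolP (m \in msupp f); last exact: mcoeff_outdom.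
have [/hasP[k _ /and3P[kn mk /eqP mk1]]|/hasPn h] := boolP (has
  (fun k => [&& (k.+1 < n)%N, (0 < m (X k))%N & m (X k.+1) == 0%N]) (iota 0 n)); last first.
  have [|ra hv e] := @xword_padded n m.
    move=> k kn mk1; apply/eqP; rewrite eqn0Ngt; apply/negP => mk.
    by have := h k; rewrite mem_iota kn mk mk1 add0n (ltnW kn) => /(_ isT).
  pose b := divcm m (mword (xword n m)).
  have le v : (mword (xword n m) v <= m v)%N.
    by case: v => j; rewrite ?mwordT // mwordX count_xword; case: ifP.
  have mE : b ** mword (cword n ra) = m by rewrite mulmC -e mulcm_divcm.
  rewrite -mE; apply: key => //.
    apply/allP => -[j|j] // jb; move: jb; rewrite -cmE_neq0 divcmE mwordX count_xword.
    by case: ltnP => [_|nj]; [rewrite subnn|rewrite (fx m mf j nj)].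
  by rewrite -tm -mE /tdeg wdegM -/(tdeg (mword _)) tdeg_mword addn0.
pose e := m (X k); pose c := divcm m (upow (X k) e).
have mE : upow (X k) e ** c = m.
  by apply: mulcm_divcm => v; rewrite upowE; case: eqP => [<-|]; rewrite ?mul1n.
have tc : tdeg c = r by rewrite -tm -mE /tdeg wdegM wdeg_upow muln0.
have ck : c (X k) = 0%N by rewrite divcmE upowE eqxx mul1n subnn.
have ck1 : c (X k.+1) = 0%N by rewrite divcmE mk1.
rewrite -mE (EQSym_shift1 _ fE kn lr tc ck ck1); apply: IH.
  apply: leq_trans potm; rewrite -mE /pot !wdegM !wdeg_upow ltn_add2r ltn_mul2l.
  by move: mk kn; rewrite -/e => ->; clear; lia.
by rewrite -tc /tdeg wdegM wdeg_upow muln0.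
Qed.

(** * Leading monomials and elimination *)

Lemma count_cword n ra i : rcomp n ra -> (i < size ra)%N ->
  count_mem (n.-1 - i)%N (cword n ra) = nth 0%N ra i.
Proof.
elim: ra n i => // x ra IH n i /andP[/= /andP[x0 pos] sz] si.
have sz' : (size ra <= n.-1)%N by case: (n) sz.
rewrite count_cat count_nseq /=; case: i si => [|i] si /=.
  rewrite subn0 eqxx mul1n; apply/eqP; rewrite -{2}[x]addn0 eqn_add2l; apply/eqP.
  by apply/count_memPn/negP => /(allP (cword_bounds sz')) /=; rewrite ltnn andbF.
have -> : (n.-1 - i.+1 = n.-1.-1 - i)%N by lia.
by rewrite IH ?/rcomp ?pos //; have -> : (n.-1 == n.-1.-1 - i)%N = false by lia.
Qed.

Lemma cword_inj n ra ra' : rcomp n ra -> rcomp n ra' -> size ra = size ra' ->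
  cword n ra = cword n ra' -> ra = ra'.
Proof.
move=> hv hv' sz e; apply: (@eq_from_nth _ 0%N) => // i si.
by rewrite -(count_cword hv si) e count_cword // -sz.
Qed.

(** A pair [(b, ra)] indexes both the element t^b P_F, F being the forest of [ra], and its leading
    monomial. *)
Definition key n (k : mon * seq nat) := k.1 ** mword (cword n k.2).
Definition iskey n r (k : mon * seq nat) := [&& tmon k.1, tdeg k.1 == r & rcomp n k.2].

(** Elements may repeat in the list, so sums are concatenations; [spannedP] merges the
    repetitions. *)
Definition spanned (S : XTPoly -> Prop) f := exists2 L : seq (XTPoly * XTPoly),
  (forall x, x \in L -> in_Zt x.1 /\ S x.2) & f = \sum_(x <- L) x.1 * x.2.

Lemma spanned0 S : spanned S 0.
Proof. by exists [::]; rewrite ?big_nil. Qed.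

Lemma spannedD S f g : spanned S f -> spanned S g -> spanned S (f + g).
Proof.
case=> L hL -> [L' hL' ->]; exists (L ++ L'); last by rewrite big_cat.
by move=> x; rewrite mem_cat => /orP[/hL|/hL'].
Qed.

Lemma spannedP S f : spanned S f -> exists (ps : seq XTPoly) (a : XTPoly -> XTPoly),
  [/\ forall p, p \in ps -> S p, forall p, p \in ps -> in_Zt (a p) &
      f = \sum_(p <- ps) a p * p].
Proof.
case=> L hL ->; exists (undup (map snd L)).
exists (fun p => \sum_(x <- L | x.2 == p) x.1); split.
- by move=> p; rewrite mem_undup => /mapP[x /hL[_ hx] ->].
- move=> p _; rewrite -big_filter; apply: suppin_sum => x.
  by rewrite mem_filter => /andP[_ /hL[]].
transitivity (\sum_(p <- undup (map snd L)) \sum_(x <- L | x.2 == p) x.1 * x.2); last first.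
  apply: eq_bigr => p _; rewrite [RHS]mulr_suml.
  by apply: eq_bigr => x /eqP ->.
rewrite (exchange_big_dep xpredT) //= big_seq [RHS]big_seq.
apply: eq_bigr => x xL; rewrite -big_filter.
have -> : [seq p <- undup (map snd L) | x.2 == p] = [:: x.2].
  rewrite (@eq_filter _ _ (pred1 x.2)) => [|p]; last by rewrite /= eq_sym.
  by rewrite filter_pred1_uniq ?undup_uniq // mem_undup map_f.
by rewrite big_seq1.
Qed.

Section Family.
Variables (P : forest -> XTPoly) (hP : double_forest_family P) (n : nat).
Let S p := exists2 ra, rcomp n ra & p = P (cforest n ra).

(** Unitriangularity in the number of parts: [cword n ra0] uses only the top [size ra0] values, so
    [word_ok_lead] with lower bound [n - size ra0] forces it to be [cword n ra]. *)
Lemma P_key ra ra0 : rcomp n ra -> rcomp n ra0 -> (size ra0 <= size ra)%N ->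
  (P (cforest n ra))@_(mword (cword n ra0)) = (ra == ra0)%:R.
Proof.
move=> hv hv0 le; case/andP: (hv0) => pos0 sz0; case/andP: (hv) => pos sz.
have bnd := cword_bounds sz0.
rewrite (P_coef hP) ?cword_sorted //; last by apply: sub_all bnd => i /andP[].
congr (nat_of_bool _)%:R; apply/idP/eqP => [hw|->]; last exact: word_ok_cword.
have e := word_ok_lead pos hw bnd.
have /e{}e : (n <= size ra + (n - size ra0))%N by clear -le sz0; lia.
have sz_eq : size ra = size ra0.
  apply/eqP; rewrite eqn_leq le andbT.
  case: ra {hv le sz e} pos hw => // x ra pos hw.
  case ew : (cword n ra0) bnd hw => [|j w] // bnd hw.
  have lw : all (leq (n - size ra0)) (j :: w) by apply: sub_all bnd => i /andP[].
  have := word_ok_size hw lw; case/andP: bnd => /andP[_ jn] _; clear -jn sz0; lia.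
exact: cword_inj hv hv0 sz_eq (esym e).
Qed.

Lemma mcoeff_P_key r k k0 c : iskey n r k -> iskey n r k0 -> (size k0.2 <= size k.2)%N ->
  (<< c *g k.1 >> * P (cforest n k.2))@_(key n k0) = if k == k0 then c else 0.
Proof.
case/and3P => tk /eqP rk vk /and3P[tk0 /eqP rk0 vk0] le.
rewrite (mcoeff_lead _ _ (@in_Zt_U c _ tk) _ tk0 rk0); last first.
  by move=> m /(fsubsetP msuppU_le); rewrite inE => /eqP ->; rewrite rk.
rewrite mcoeffU P_key //; case: k k0 {tk rk tk0 rk0 vk vk0 le} => b ra [b0 ra0] /=.
by rewrite xpair_eqE; case: eqP => _; case: eqP => _; rewrite ?mulr1 ?mulr0 ?mul0r.
Qed.

(** The leading coefficient is 1, so the leading monomial lies in the support and homogeneity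
    applies. *)
Lemma P_mdeg ra m : rcomp n ra -> m \in msupp (P (cforest n ra)) ->
  mdeg m = mdeg (mword (cword n ra)).
Proof.
move=> hv; case: hP => /(_ (cforest n ra))[d hd] _ _ /hd ->; apply/esym/hd.
by rewrite -mcoeff_neq0 P_key // eqxx oner_eq0.
Qed.

(** Invariant of the elimination: [r] grows while [D] stays fixed, and r > D leaves an empty
    support. *)
Definition inv r D f := [/\ EQSym n f, suppin (fun m => r <= tdeg m)%N f &
  suppin (fun m => mdeg m <= D)%N f].

(** Each key with [l] parts in the support is cancelled by a multiple of its t^b P_F. That element
    has coefficient 1 at its own key and 0 at every other key of t-degree [r] with at most [l]
    parts, so the earlier zeros survive. *)
Lemma span_step r D l f : inv r D f ->
  (forall k, iskey n r k -> (size k.2 < l)%N -> f@_(key n k) = 0) ->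
  exists g, [/\ spanned S g, inv r D (f - g) &
    forall k, iskey n r k -> (size k.2 < l.+1)%N -> (f - g)@_(key n k) = 0].
Proof.
move=> [fE fr fD] fl.
(* Reading the exponents down from [n.-1] recovers a key from its monomial, so the keys in the
   support of [f] form a finite list. *)
pose raof m := [seq m (X (n.-1 - i)%N) | i <- iota 0 l].
pose kof m := (divcm m (mword (cword n (raof m))), raof m).
pose good k := [&& iskey n r k, size k.2 == l & key n k \in msupp f].
pose ks := [seq k <- undup [seq kof m | m <- msupp f] | good k].
have mem_ks k : (k \in ks) = good k.
  rewrite mem_filter mem_undup; case: (boolP (good k)) => //=.
  case: k => b ra /and3P[/and3P[tb rb vb] /eqP sl kf].
  apply/mapP; exists (key n (b, ra)) => //.
  have er : raof (key n (b, ra)) = ra.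
    apply: (@eq_from_nth _ 0%N); first by rewrite size_map size_iota.
    move=> i; rewrite size_map size_iota => il.
    rewrite (nth_map 0%N) ?size_iota // nth_iota // add0n /key cmM (tmonX _ tb) mwordX.
    by rewrite count_cword // sl.
  rewrite /kof er; congr pair; apply/eqP/cmP => v.
  by rewrite divcmE /key cmM addnK.
pose F k := << f@_(key n k) *g k.1 >> * P (cforest n k.2).
exists (\sum_(k <- ks) F k).
have ksP k : k \in ks -> good k by rewrite mem_ks.
split.
- exists [seq (<< f@_(key n k) *g k.1 >>, P (cforest n k.2)) | k <- ks]; last by rewrite big_map.
  move=> x /mapP[k /ksP/and3P[/and3P[tb _ vb] _ _] ->]; split; first exact: in_Zt_U.
  by exists k.2.
- split.
  + apply: EQSymB fE _; apply: EQSym_sum => k /ksP/and3P[/and3P[tb _ vb] _ _].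
    by apply: EQSymM; [apply: in_Zt_U|apply: P_EQSym].
  + apply: suppinB fr _; apply: suppin_sum => k /ksP/and3P[/and3P[_ /eqP rb _] _ _].
    move=> m /msuppM_le[c [m' [/(fsubsetP msuppU_le)]]]; rewrite inE => /eqP -> _ ->.
    by rewrite /tdeg wdegM -/(tdeg k.1) rb leq_addr.
  (* By homogeneity every subtracted monomial has the degree of a key in the support of [f]. *)
  apply: (suppinB fD); apply: suppin_sum => k /ksP/and3P[/and3P[_ _ vb] _ /fD kD].
  move=> m /msuppM_le[c [m' [/(fsubsetP msuppU_le)]]]; rewrite inE => /eqP -> m'P ->.
  by apply: leq_trans kD; rewrite /key !mdegM (P_mdeg vb m'P).
move=> k0 hk0 sl; apply: etrans (mcoeffB _ _ _) _; rewrite [Y in _ - Y]mcoeff_sum.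
apply/eqP; rewrite subr_eq0; apply/eqP/esym.
transitivity (\sum_(k <- ks) if k == k0 then f@_(key n k0) else 0).
  rewrite big_seq [RHS]big_seq; apply: eq_bigr => k /ksP/and3P[hk /eqP kl _].
  have le : (size k0.2 <= size k.2)%N by rewrite kl.
  by rewrite /F (mcoeff_P_key _ hk hk0 le); case: eqP => [->|].
rewrite -big_mkcond /= -big_filter.
have [k0s|k0s] := boolP (k0 \in ks).
  by rewrite filter_pred1_uniq ?big_seq1 // filter_uniq ?undup_uniq.
have -> : [seq k <- ks | k == k0] = [::].
  by apply/eqP; rewrite -(negbK (_ == _)) -has_filter has_pred1.
rewrite big_nil; apply/esym; move: sl; rewrite ltnS leq_eqVlt => /orP[/eqP sl|]; last exact: fl.
by apply: mcoeff_outdom; apply: contra k0s => kf; rewrite mem_ks /good hk0 sl eqxx.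
Qed.

Lemma span_level r D f l : inv r D f -> exists g, [/\ spanned S g, inv r D (f - g) &
    forall k, iskey n r k -> (size k.2 < l)%N -> (f - g)@_(key n k) = 0].
Proof.
move=> fi; elim: l => [|l [g [gS gi gl]]].
  by exists 0; split=> [||k _ /[!ltn0]]; [exact: spanned0|rewrite subr0|].
have [g' [gS' gi' gl']] := span_step gi gl; exists (g + g').
by rewrite opprD addrA; split; [apply: spannedD|apply: gi'|apply: gl'].
Qed.

Lemma EQSym_spanned f : EQSym n f -> spanned S f.
Proof.
move=> fE; pose D := (\max_(m <- msupp f) mdeg m)%N.
have : inv 0 D f.
  split=> // m mf; exact: (@leq_bigmax_seq _ _ xpredT (fun m : mon => mdeg m) _ mf isT).
move: D => D; have [d] := ubnP (D.+1 - 0)%N; move: 0%N => r.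
elim: d r f {fE} => // d IH r f hd fi.
have [rD|Dr] := leqP r D; last first.
  suff -> : f = 0 by exact: spanned0.
  apply/eqP; rewrite -msupp_eq0; apply/eqP/fsetP => m; rewrite inE.
  apply/negP => mf; case: fi => _ /(_ m mf) h1 /(_ m mf) h2.
  by have := leq_trans h1 (leq_trans (leq_tdeg_mdeg m) h2); rewrite leqNgt Dr.
(* Compositions have at most [n] parts, so level [n.+1] clears all keys of t-degree [r]; by
   [EQSym_key] nothing of that t-degree is left and [r] can be raised. *)
have [g [gS [hE hr hD] gl]] := span_level n.+1 fi.
have -> : f = (f - g) + g by rewrite subrK.
apply: spannedD gS; apply: (IH r.+1); first by clear -hd rD; lia.
split=> // m mf; rewrite ltn_neqAle hr // andbT; apply/eqP => e.
move: mf; rewrite -mcoeff_neq0 (EQSym_key hE hr) ?eqxx // => b ra tb rb vb.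
apply: (gl (b, ra)); first by rewrite /iskey tb rb eqxx vb.
by case/andP: vb.
Qed.

(** Strong induction on the t-degree [r] of the coefficient monomial [b], then on the number [l] of
    parts. *)
Lemma P_independent (ps : seq XTPoly) (a : XTPoly -> XTPoly) : uniq ps ->
  (forall p, p \in ps -> S p) -> (forall p, p \in ps -> in_Zt (a p)) ->
  \sum_(p <- ps) a p * p = 0 -> forall p, p \in ps -> a p = 0.
Proof.
move=> ups hS ha sum0.
suff main r : forall b p, p \in ps -> tmon b -> tdeg b = r -> (a p)@_b = 0.
  move=> p pps; apply/malgP => b; rewrite mcoeff0.
  have [bs|] := boolP (b \in msupp (a p)); last exact: mcoeff_outdom.
  by apply: (main (tdeg b)) => //; apply: in_Zt_tmon (ha _ pps) bs.
elim/ltn_ind: r => r IHr.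
have lr p : p \in ps -> {in msupp (a p), forall k, (r <= tdeg k)%N}.
  move=> pps k ka; rewrite leqNgt; apply/negP => lt.
  by move: (ka); rewrite -mcoeff_neq0 (IHr _ lt) ?eqxx // (in_Zt_tmon (ha _ pps) ka).
suff main l : forall b p ra, p \in ps -> rcomp n ra -> p = P (cforest n ra) -> size ra = l ->
    tmon b -> tdeg b = r -> (a p)@_b = 0.
  by move=> b p pps; have [ra hv pE] := hS p pps; apply: (main (size ra) b p ra).
elim/ltn_ind: l => l IHl b p ra pps hv pE sl tb rb.
(* At the leading monomial of t^b p, elements with fewer parts drop out by induction and all others
   except [p] by [P_key]. *)
have term q : q \in ps ->
    (a q * q)@_(b ** mword (cword n ra)) = if q == p then (a p)@_b else 0.
  move=> qps; rewrite (mcoeff_lead _ _ (ha _ qps) (lr _ qps) tb rb).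
  have [ra' hv' qE] := hS q qps.
  case: eqP => [->|qp]; first by rewrite {2}pE P_key // eqxx mulr1.
  have [lt|le] := ltnP (size ra') (size ra).
    rewrite sl in lt.
    by rewrite (IHl _ lt b q ra' qps hv' qE erefl tb rb) mul0r.
  rewrite {2}qE P_key //; case: eqP => [e|_]; last exact: mulr0.
  by case: qp; rewrite qE e -pE.
have := congr1 (mcoeff (b ** mword (cword n ra))) sum0.
rewrite [LHS]mcoeff_sum mcoeff0 => <-; rewrite big_seq.
apply/esym; apply: etrans (eq_bigr _ term) _.
by rewrite -big_seq -big_mkcond /= -big_filter filter_pred1_uniq // big_seq1.
Qed.

End Family.

Lemma zigzag_padded n F c : padded_comp n c -> has_code F c ->
  exists2 ra, rcomp n ra & c = nseq (n - size ra) 0%N ++ rev ra /\ F = cforest n ra.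
Proof.
case/padded_compP => ra hv -> hF; exists ra => //; split=> //.
by apply: code_inj => i; rewrite hF (code_cforest hv).
Qed.

Theorem theorem4p12 (n : nat) (P : forest -> XTPoly) :
  (0 < n)%N -> double_forest_family P ->
  [/\ (* F_c(x_1..x_n; 0) = F_c(x_1..x_n), where F_c(x;t) = P_{F_c} *)
      forall (c : seq nat) (F : forest),
        padded_comp n c -> has_code F c -> at_t0 (P F) = fundamental n c,
      (* {P_F : F in Zigzag_n} = {F_c(x;t) : c padded composition of length n} *)
      forall p : XTPoly,
        (exists F, zigzag n F /\ p = P F) <->
        (exists (c : seq nat) (F : forest), [/\ padded_comp n c, has_code F c & p = P F]) &
      (* this set is a Z[t]-basis of EQSym_n *)
      is_Zt_basis_EQSym n (fun p => exists F, zigzag n F /\ p = P F)].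
Proof.
move=> n0 hP.
have zz p : (exists F, zigzag n F /\ p = P F) <->
    (exists2 ra, rcomp n ra & p = P (cforest n ra)).
  split=> [[F [/(zigzagP _ n0)[ra hv ->] ->]]|[ra hv ->]]; first by exists ra.
  by exists (cforest n ra); split=> //; apply/zigzagP => //; exists ra.
split.
- move=> c F hc hF; have [ra hv [-> ->]] := zigzag_padded hc hF.
  exact: P_at_t0.
- move=> p; apply: iff_trans (zz p) _; split=> [[ra hv ->]|[c [F [hc hF ->]]]].
    exists (nseq (n - size ra) 0%N ++ rev ra), (cforest n ra); split=> //.
      by apply/padded_compP; exists ra.
    exact: code_cforest.
  by have [ra hv [_ ->]] := zigzag_padded hc hF; exists ra.
split.
- by move=> p /zz[ra hv ->]; apply: P_EQSym.
- move=> f /(EQSym_spanned hP)/spannedP[ps [a [hS ha ->]]]; exists ps, a; split=> //.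
  by move=> p /hS/zz.
move=> ps a ups hS; apply: (P_independent hP ups) => p /hS/zz; exact.
Qed.
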